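(* Let $\Theta,\mathcal A,h,p,q$ satisfy the standing assumptions in the context, and consider the min-max zero-sum game $\min_{\boldsymbol\theta\in\Theta}\max_{\boldsymbol\alpha\in\mathcal A}\big(f(\boldsymbol\theta,\boldsymbol\alpha)=h(\boldsymbol\theta,\boldsymbol\alpha)-p(\boldsymbol\alpha)+q(\boldsymbol\theta)\big)$, where $h(\boldsymbol\theta,\boldsymbol\alpha)$ is concave in $\boldsymbol\alpha$ for any given $\boldsymbol\theta$. Let $\epsilon>0$, $\hat{\boldsymbol\alpha}\in\mathcal A$ and $\lambda=\min\{L_{22},\frac{\epsilon}{2\sqrt2R}\}$. Define $f_\lambda(\boldsymbol\theta,\boldsymbol\alpha)=f(\boldsymbol\theta,\boldsymbol\alpha)-\frac\lambda2\|\boldsymbol\alpha-\hat{\boldsymbol\alpha}\|^2$, whose smooth part is $h_\lambda(\boldsymbol\theta,\boldsymbol\alpha)=h(\boldsymbol\theta,\boldsymbol\alpha)-\frac\lambda2\|\boldsymbol\alpha-\hat{\boldsymbol\alpha}\|^2$, and $g_\lambda(\boldsymbol\theta)=\max_{\boldsymbol\alpha\in\mathcal A}\big[h(\boldsymbol\theta,\boldsymbol\alpha)-\frac\lambda2\|\boldsymbol\alpha-\hat{\boldsymbol\alpha}\|^2-p(\boldsymbol\alpha)\big]$. Let $D=g_\lambda(\boldsymbol\theta_0)+q(\boldsymbol\theta_0)-\min_{\boldsymbol\theta\in\Theta}\big(g_\lambda(\boldsymbol\theta)+q(\boldsymbol\theta)\big)$, let $L_{g_\lambda}=L_{11}+\frac{L_{12}^2}{\lambda}$,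 which is a Lipschitz constant of the gradient of $g_\lambda$, and let $\kappa=\frac{L_{22}+\lambda}{\lambda}$. Apply the Multi-step Accelerated Proximal Gradient Descent-Ascent algorithm (see context) to the regularized game $\min_{\boldsymbol\theta\in\Theta}\max_{\boldsymbol\alpha\in\mathcal A}f_\lambda(\boldsymbol\theta,\boldsymbol\alpha)$, i.e. with smooth part $\phi=h_\lambda$, with $\eta_1=\frac1{L_{22}+\lambda}$, $\eta_2=\frac1{L_{g_\lambda}}$, $N=\sqrt{\frac{8(L_{22}+\lambda)}{\lambda}}-1$, and choose $K$ and $T$ large enough such that $$T\ \ge\ N_T(\epsilon)=\frac{8L_{g_\lambda}D}{\epsilon^2}\qquad\text{and}\qquad K\ \ge\ N_K(\epsilon)=2\sqrt{8\kappa}\left(C+2\log\Big(\frac2\epsilon\Big)+\frac12\log\Big(\frac{2\Delta}{\lambda}\Big)\right),$$ where $C=\max\big\{2\log2+\log(L_{g_\lambda}L_{12}R),\ \log(L_{22}+\lambda)+\log\big(2(L_{22}+\lambda)R+g^\lambda_{\max}+L_p+R\big)\big\}$, and $g^\lambda_{\max}$ and $\Delta$ are as in the context; thus $N_T(\epsilon)=\mathcal O(\epsilon^{-3})$ and $N_K(\epsilon)=\mathcal O(\epsilon^{-1/2}\log(\epsilon^{-1}))$. Then there exists $t\in\{0,\dots,T-1\}$ such that $(\boldsymbol\theta_t,\boldsymbol\alpha_{t+1})$ is an $\epsilon$-first-order Nash equilibrium of the original game $\min_{\boldsymbol\theta\in\Theta}\max_{\boldsymbol\alpha\in\mathcal 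A}f(\boldsymbol\theta,\boldsymbol\alpha)$.
   Context: Norms are Euclidean. Standing assumptions: $\Theta\subseteq\mathbb R^{d_\theta}$ and $\mathcal A\subseteq\mathbb R^{d_\alpha}$ are convex and compact, and there are two separate balls of radius $R$ containing $\mathcal A$ and $\Theta$, respectively. $h(\boldsymbol\theta,\boldsymbol\alpha)$ is continuously differentiable in both arguments; $p$ and $q$ are convex and possibly non-differentiable, $p$ is $L_p$-Lipschitz continuous, $q$ is continuous. There are constants $L_{11},L_{22},L_{12}$ such that for all $\boldsymbol\theta,\boldsymbol\theta_1,\boldsymbol\theta_2\in\Theta$ and $\boldsymbol\alpha,\boldsymbol\alpha_1,\boldsymbol\alpha_2\in\mathcal A$: $\|\nabla_{\boldsymbol\theta}h(\boldsymbol\theta_1,\boldsymbol\alpha)-\nabla_{\boldsymbol\theta}h(\boldsymbol\theta_2,\boldsymbol\alpha)\|\le L_{11}\|\boldsymbol\theta_1-\boldsymbol\theta_2\|$, $\|\nabla_{\boldsymbol\alpha}h(\boldsymbol\theta,\boldsymbol\alpha_1)-\nabla_{\boldsymbol\alpha}h(\boldsymbol\theta,\boldsymbol\alpha_2)\|\le L_{22}\|\boldsymbol\alpha_1-\boldsymbol\alpha_2\|$, $\|\nabla_{\boldsymbol\alpha}h(\boldsymbol\theta_1,\boldsymbol\alpha)-\nabla_{\boldsymbol\alpha}h(\boldsymbol\theta_2,\boldsymbol\alpha)\|\le L_{12}\|\boldsymbol\theta_1-\boldsymbol\theta_2\|$, $\|\nabla_{\boldsymbol\theta}h(\boldsymbol\theta,\boldsymbol\alpha_1)-\nabla_{\boldsymbol\theta}h(\boldsymbol\theta,\boldsymbol\alpha_2)\|\le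 L_{12}\|\boldsymbol\alpha_1-\boldsymbol\alpha_2\|$. The quantities $g^\lambda_{\max}$ and $\Delta$: at iteration $t$, $g^\lambda_{\max}=\max_{\boldsymbol\alpha\in\mathcal A}\|\nabla_{\boldsymbol\alpha}h(\boldsymbol\theta_t,\boldsymbol\alpha)\|+\lambda R$, and $\Delta$ is a number with $g_\lambda(\boldsymbol\theta_t)-\big(h_\lambda(\boldsymbol\theta_t,\boldsymbol\alpha_t)-p(\boldsymbol\alpha_t)\big)<\Delta$, where $\boldsymbol\alpha_t$ is the starting point of the inner loop at iteration $t$; the condition on $K$ is understood to hold for the iterations $t=0,\dots,T-1$. $\epsilon$-first-order Nash equilibrium ($\epsilon$-FNE) of the original game: a point $(\bar{\boldsymbol\theta},\bar{\boldsymbol\alpha})$ with $\mathcal X(\bar{\boldsymbol\theta},\bar{\boldsymbol\alpha})\le\epsilon^2$ and $\mathcal Y(\bar{\boldsymbol\theta},\bar{\boldsymbol\alpha})\le\epsilon^2$, where $$\mathcal X(\bar{\boldsymbol\theta},\bar{\boldsymbol\alpha})=-2L_{11}\min_{\boldsymbol\theta\in\Theta}\Big[\langle\nabla_{\boldsymbol\theta}h(\bar{\boldsymbol\theta},\bar{\boldsymbol\alpha}),\boldsymbol\theta-\bar{\boldsymbol\theta}\rangle+q(\boldsymbol\theta)-q(\bar{\boldsymbol\theta})+\tfrac{L_{11}}2\|\boldsymbol\theta-\bar{\boldsymbol\theta}\|^2\Big],$$ $$\mathcal Y(\bar{\boldsymbol\theta},\bar{\boldsymbol\alpha})=2L_{22}\max_{\boldsymbol\alpha\in\mathcal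 A}\Big[\langle\nabla_{\boldsymbol\alpha}h(\bar{\boldsymbol\theta},\bar{\boldsymbol\alpha}),\boldsymbol\alpha-\bar{\boldsymbol\alpha}\rangle-p(\boldsymbol\alpha)+p(\bar{\boldsymbol\alpha})-\tfrac{L_{22}}2\|\boldsymbol\alpha-\bar{\boldsymbol\alpha}\|^2\Big].$$ Multi-step Accelerated Proximal Gradient Descent-Ascent algorithm for a game $\min_{\boldsymbol\theta\in\Theta}\max_{\boldsymbol\alpha\in\mathcal A}\phi(\boldsymbol\theta,\boldsymbol\alpha)-p(\boldsymbol\alpha)+q(\boldsymbol\theta)$ with smooth part $\phi$; inputs $K,T,N,\eta_1,\eta_2$, $\boldsymbol\alpha_0\in\mathcal A$, $\boldsymbol\theta_0\in\Theta$. Proximal operators with step size $\eta$: $$\rho_{\boldsymbol\alpha}(\tilde{\boldsymbol\theta},\tilde{\boldsymbol\alpha},\eta)=\arg\max_{\boldsymbol\alpha\in\mathcal A}\ \langle\nabla_{\boldsymbol\alpha}\phi(\tilde{\boldsymbol\theta},\tilde{\boldsymbol\alpha}),\boldsymbol\alpha-\tilde{\boldsymbol\alpha}\rangle-\tfrac1{2\eta}\|\boldsymbol\alpha-\tilde{\boldsymbol\alpha}\|^2-p(\boldsymbol\alpha),$$ $$\rho_{\boldsymbol\theta}(\tilde{\boldsymbol\theta},\tilde{\boldsymbol\alpha},\eta)=\arg\min_{\boldsymbol\theta\in\Theta}\ \langle\nabla_{\boldsymbol\theta}\phi(\tilde{\boldsymbol\theta},\tilde{\boldsymbol\alpha}),\boldsymbol\theta-\tilde{\boldsymbol\theta}\rangle+\tfrac1{2\eta}\|\boldsymbol\theta-\tilde{\boldsymbol\theta}\|^2+q(\boldsymbol\theta).$$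 For $t=0,\dots,T-1$: (i) for $k=0,1,\dots,\lfloor K/N\rfloor$: set $\beta_1=1$, $\mathbf x_0=\boldsymbol\alpha_t$, and $\mathbf y_1=\mathbf x_0$ if $k=0$, while for $k\ge1$ set $\mathbf y_1$ equal to the $\mathbf x_N$ produced in round $k-1$; then for $j=1,\dots,N$ set $\mathbf x_j=\rho_{\boldsymbol\alpha}(\boldsymbol\theta_t,\mathbf y_j,\eta_1)$, $\beta_{j+1}=\frac{1+\sqrt{1+4\beta_j^2}}2$, $\mathbf y_{j+1}=\mathbf x_j+\frac{\beta_j-1}{\beta_{j+1}}(\mathbf x_j-\mathbf x_{j-1})$; (ii) set $\boldsymbol\alpha_{t+1}$ equal to the final $\mathbf x_N$; (iii) set $\boldsymbol\theta_{t+1}=\rho_{\boldsymbol\theta}(\boldsymbol\theta_t,\boldsymbol\alpha_{t+1},\eta_2)$.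
   Formalization: Added: all extrapolated points y_j lie in a convex set E containing 𝒜 on which h(θ,·) is concave with L22-Lipschitz gradient (the claim fails if this holds only on 𝒜); also T ≥ 1, L12, L22 > 0, L11, L_p ≥ 0, h is C¹ on the whole space, and N is rounded up to an integer. *)

(* Defs.v *)
From HB Require Import structures.
From mathcomp Require Import all_boot all_order all_algebra.
From mathcomp Require Import all_classical all_reals all_analysis.

Set Implicit Arguments.
Unset Strict Implicit.
Unset Printing Implicit Defensive.
Import Order.TTheory GRing.Theory Num.Theory.
Import numFieldNormedType.Exports.
Local Open Scope classical_set_scope.
Local Open Scope ring_scope.

Section euclidean.
Context {R : realType} {n : nat}.

(* The library norm on 'rV[R]_n is the sup norm: it induces the topology (and
   hence compactness, continuity, differentiability) but is not the Euclidean
   norm, which is enorm. *)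
Definition dot (u v : 'rV[R]_n) : R := \sum_(i < n) u 0 i * v 0 i.
Definition enorm (u : 'rV[R]_n) : R := Num.sqrt (dot u u).

Definition grad (f : 'rV[R]_n -> R) (x : 'rV[R]_n) : 'rV[R]_n :=
  \row_(i < n) 'D_(delta_mx 0 i) (f : 'rV[R]_n -> R^o) x.

Definition in_ball (S : set 'rV[R]_n) (c : 'rV[R]_n) (r : R) :=
  forall x, S x -> enorm (x - c) <= r.

Definition is_argmax (S : set 'rV[R]_n) (f : 'rV[R]_n -> R) (x : 'rV[R]_n) :=
  S x /\ forall y, S y -> f y <= f x.
Definition is_argmin (S : set 'rV[R]_n) (f : 'rV[R]_n -> R) (x : 'rV[R]_n) :=
  S x /\ forall y, S y -> f x <= f y.

(* All maxima and minima below are of continuous functions over nonempty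
   compact sets, so that sup and inf are attained. *)
Definition maxval (S : set 'rV[R]_n) (f : 'rV[R]_n -> R) : R := sup (f @` S).
Definition minval (S : set 'rV[R]_n) (f : 'rV[R]_n -> R) : R := inf (f @` S).

End euclidean.

Section game.
Context {R : realType} {m n : nat}.
Implicit Types (Th : set 'rV[R]_m) (Al : set 'rV[R]_n).
Implicit Types (h phi : 'rV[R]_m -> 'rV[R]_n -> R).
Implicit Types (p : 'rV[R]_n -> R) (q : 'rV[R]_m -> R).
Implicit Types (th : 'rV[R]_m) (al : 'rV[R]_n).

Definition grad_th phi th al : 'rV[R]_m := grad (phi ^~ al) th.
Definition grad_al phi th al : 'rV[R]_n := grad (phi th) al.

(* Existence of both partial gradients everywhere together with their joint
   continuity is the usual C^1 condition on the product space. *)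
Definition C1 phi :=
  [/\ forall th al, differentiable ((phi ^~ al) : 'rV[R]_m -> R^o) th,
      forall th al, differentiable (phi th : 'rV[R]_n -> R^o) al,
      continuous (fun z : 'rV[R]_m * 'rV[R]_n => grad_th phi z.1 z.2)
    & continuous (fun z : 'rV[R]_m * 'rV[R]_n => grad_al phi z.1 z.2)].

Record standing Th Al h p q (rad L11 L22 L12 Lp : R) : Prop := Standing {
  convex_Th : convex_set Th;
  compact_Th : compact Th;
  convex_Al : convex_set Al;
  compact_Al : compact Al;
  rad_gt0 : 0 < rad;
  ball_Th : exists c, in_ball Th c rad;
  ball_Al : exists c, in_ball Al c rad;
  C1_h : C1 h;
  convex_p : convex_function Al p;
  Lp_ge0 : 0 <= Lp;
  lip_p : forall a1 a2, Al a1 -> Al a2 -> `|p a1 - p a2| <= Lp * enorm (a1 - a2);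
  convex_q : convex_function Th q;
  cont_q : {within Th, continuous (q : 'rV[R]_m -> R^o)};
  (* L22 and L12 occur in a denominator and inside a logarithm, hence > 0. *)
  L11_ge0 : 0 <= L11;
  L22_gt0 : 0 < L22;
  L12_gt0 : 0 < L12;
  lip11 : forall t1 t2 a, Th t1 -> Th t2 -> Al a ->
    enorm (grad_th h t1 a - grad_th h t2 a) <= L11 * enorm (t1 - t2);
  lip22 : forall t a1 a2, Th t -> Al a1 -> Al a2 ->
    enorm (grad_al h t a1 - grad_al h t a2) <= L22 * enorm (a1 - a2);
  lip12 : forall t1 t2 a, Th t1 -> Th t2 -> Al a ->
    enorm (grad_al h t1 a - grad_al h t2 a) <= L12 * enorm (t1 - t2);
  lip21 : forall t a1 a2, Th t -> Al a1 -> Al a2 ->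
    enorm (grad_th h t a1 - grad_th h t a2) <= L12 * enorm (a1 - a2)
}.

(* The extrapolated points y_j of the accelerated method may leave Al, where
   the bounds of [standing] say nothing about the gradient that the algorithm
   evaluates at y_j.  E is a convex superset of Al on which
   h(theta, .) is concave with L22-Lipschitz gradient; E := Al requires nothing
   beyond concavity on Al and [lip22], and E := setT is the case of a globally
   smooth concave h(theta, .). *)
Record concave_domain Th Al h (L22 : R) (E : set 'rV[R]_n) : Prop :=
  ConcaveDomain {
  convex_E : convex_set E;
  sub_Al_E : Al `<=` E;
  concave_h : forall t, Th t -> convex_function E (fun a => - h t a);
  lip22_E : forall t a1 a2, Th t -> E a1 -> E a2 ->
    enorm (grad_al h t a1 - grad_al h t a2) <= L22 * enorm (a1 - a2)
}.

Definition X_meas Th h q (L11 : R) th al : R :=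
  - (2 * L11) * minval Th (fun t =>
      dot (grad_th h th al) (t - th) + q t - q th
      + L11 / 2 * enorm (t - th) ^+ 2).

Definition Y_meas Al h p (L22 : R) th al : R :=
  2 * L22 * maxval Al (fun a =>
      dot (grad_al h th al) (a - al) - p a + p al
      - L22 / 2 * enorm (a - al) ^+ 2).

Definition eps_FNE Th Al h p q (L11 L22 e : R) th al :=
  [/\ Th th, Al al, X_meas Th h q L11 th al <= e ^+ 2
    & Y_meas Al h p L22 th al <= e ^+ 2].

Definition prox_al Al phi p (eta : R) th al : set 'rV[R]_n :=
  is_argmax Al (fun a =>
    dot (grad_al phi th al) (a - al)
    - (2 * eta)^-1 * enorm (a - al) ^+ 2 - p a).

Definition prox_th Th phi q (eta : R) th al : set 'rV[R]_m :=
  is_argmin Th (fun t =>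
    dot (grad_th phi th al) (t - th)
    + (2 * eta)^-1 * enorm (t - th) ^+ 2 + q t).

(* beta 1 = 1; beta 0 is not used. *)
Definition beta (j : nat) : R :=
  iter j.-1 (fun b => (1 + Num.sqrt (1 + 4 * b ^+ 2)) / 2) 1.

(* x t k j and y t k j are the points x_j and y_j of round k of the inner loop
   at iteration t. *)
Record run Th Al phi p q (K T N : nat) (eta1 eta2 : R)
    (th : nat -> 'rV[R]_m) (al : nat -> 'rV[R]_n)
    (x y : nat -> nat -> nat -> 'rV[R]_n) : Prop := Run {
  run_th0 : Th (th 0%N);
  run_al0 : Al (al 0%N);
  run_x0 : forall t k, (t < T)%N -> (k <= K %/ N)%N -> x t k 0%N = al t;
  run_y1_first : forall t, (t < T)%N -> y t 0%N 1%N = x t 0%N 0%N;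
  run_y1_next : forall t k, (t < T)%N -> (k < K %/ N)%N ->
    y t k.+1 1%N = x t k N;
  run_x : forall t k j, (t < T)%N -> (k <= K %/ N)%N -> (1 <= j <= N)%N ->
    prox_al Al phi p eta1 (th t) (y t k j) (x t k j);
  run_y : forall t k j, (t < T)%N -> (k <= K %/ N)%N -> (1 <= j <= N)%N ->
    y t k j.+1 =
      x t k j + ((beta j - 1) / beta j.+1) *: (x t k j - x t k j.-1);
  run_al : forall t, (t < T)%N -> al t.+1 = x t (K %/ N)%N N;
  run_th : forall t, (t < T)%N ->
    prox_th Th phi q eta2 (th t) (al t.+1) (th t.+1)
}.

Definition lambda (L22 rad e : R) : R :=
  Num.min L22 (e / (2 * Num.sqrt 2 * rad)).

Definition h_reg h (ahat : 'rV[R]_n) (l : R) th al : R :=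
  h th al - l / 2 * enorm (al - ahat) ^+ 2.

Definition g_reg Al h p ahat (l : R) th : R :=
  maxval Al (fun a => h_reg h ahat l th a - p a).

Definition gap_D Th Al h p q ahat (l : R) (th0 : 'rV[R]_m) : R :=
  g_reg Al h p ahat l th0 + q th0
  - minval Th (fun t => g_reg Al h p ahat l t + q t).

Definition L_g (L11 L12 l : R) : R := L11 + L12 ^+ 2 / l.

Definition kappa (L22 l : R) : R := (L22 + l) / l.

Definition g_max Al h (rad l : R) th : R :=
  maxval Al (fun a => enorm (grad_al h th a)) + l * rad.

(* The number of steps is an integer, so sqrt (8 (L22 + l) / l) - 1 is rounded
   up: then (N + 1)^2 >= 8 (L22 + l) / l, with equality if it is an integer. *)
Definition N_inner (L22 l : R) : nat :=
  `|Num.ceil (Num.sqrt (8 * (L22 + l) / l) - 1)|%N.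

Definition N_T Th Al h p q (rad L11 L22 L12 : R) ahat th0 (e : R) : R :=
  let l := lambda L22 rad e in
  8 * L_g L11 L12 l * gap_D Th Al h p q ahat l th0 / e ^+ 2.

Definition C_const (rad L11 L22 L12 Lp gmax l : R) : R :=
  Num.max (2 * ln 2 + ln (L_g L11 L12 l * L12 * rad))
          (ln (L22 + l) + ln (2 * (L22 + l) * rad + gmax + Lp + rad)).

(* th is the iterate at which g_max is evaluated and Delta the bound on the
   inner optimality gap at that iteration. *)
Definition N_K Al h (rad L11 L22 L12 Lp : R) th (Delta e : R) : R :=
  let l := lambda L22 rad e in
  2 * Num.sqrt (8 * kappa L22 l) *
  (C_const rad L11 L22 L12 Lp (g_max Al h rad l th) l
   + 2 * ln (2 / e) + 2^-1 * ln (2 * Delta / l)).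

End game.

(* Main.v *)
From HB Require Import structures.
Require Import Defs.
From mathcomp Require Import all_boot all_order all_algebra.
From mathcomp Require Import all_classical all_reals all_analysis.
From mathcomp Require Import ring lra.

Set Implicit Arguments.
Unset Strict Implicit.
Unset Printing Implicit Defensive.
Import Order.TTheory GRing.Theory Num.Theory.
Import numFieldNormedType.Exports.
Local Open Scope classical_set_scope.
Local Open Scope ring_scope.

(* With L = L22 + l and a* the maximizer of the regularized inner problem, a
   round of N accelerated steps leaves at most half of the inner gap, and at
   most l rad^2 whatever the gap was.  After r = K/N + 1 rounds this gives two
   bounds on the final gap d, namely 2^r d <= Delta and 2^r d <= 2 l rad^2,
   while the condition on K only yields, for A either 4 L_g L12 rad or
   L (2 L rad + g_max + Lp + rad),
     32 A^2 Delta <= l eps^4 e^r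
   with natural logarithms.  The first bound is too weak by itself, because
   2 < e; multiplying the two gives (4 A d)^2 <= (e/4)^r (l rad eps^2)^2, which
   suffices since e < 4, provided that the equilibrium measures are controlled
   by d alone: Y by applying the descent lemma at a point of the segment from
   al to a competitor, and X through the error L12 |al - a*| in the gradient,
   needed only up to 3/8 eps.  Danskin's theorem gives the gradient of g_reg,
   so that the outer iteration is an inexact proximal gradient descent. *)

(** * Euclidean space and calculus along segments *)

Section euclidean_space.
Context {R : realType} {n : nat}.
Implicit Types (u v w : 'rV[R]_n) (a : R).

Lemma dotC u v : dot u v = dot v u.
Proof. by apply: eq_bigr => i _; rewrite mulrC. Qed.

Lemma dotDl u v w : dot (u + v) w = dot u w + dot v w.
Proof. by rewrite -big_split; apply: eq_bigr => i _; rewrite mxE mulrDl. Qed.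

Lemma dotZl a u v : dot (a *: u) v = a * dot u v.
Proof. by rewrite mulr_sumr; apply: eq_bigr => i _; rewrite mxE mulrA. Qed.

Lemma dotNl u v : dot (- u) v = - dot u v.
Proof. by rewrite -scaleN1r dotZl mulN1r. Qed.

Lemma dotDr u v w : dot u (v + w) = dot u v + dot u w.
Proof. by rewrite dotC dotDl !(dotC u). Qed.

Lemma dotZr a u v : dot u (a *: v) = a * dot u v.
Proof. by rewrite dotC dotZl dotC. Qed.

Lemma dotNr u v : dot u (- v) = - dot u v.
Proof. by rewrite dotC dotNl dotC. Qed.

Definition dotE := (dotDl, dotDr, dotNl, dotNr, dotZl, dotZr).

Lemma dot0l v : dot 0 v = 0.
Proof. by rewrite -(scale0r v) dotZl mul0r. Qed.

Lemma dot_delta u i : dot u (delta_mx 0 i) = u 0 i.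
Proof.
rewrite /dot (bigD1 i)//= big1 ?addr0 => [|j ji]; rewrite !mxE eqxx; first by rewrite eqxx mulr1.
by rewrite (negbTE ji) mulr0.
Qed.

Lemma dot_ge0 u : 0 <= dot u u.
Proof. by apply: sumr_ge0 => i _; rewrite -expr2 sqr_ge0. Qed.

Lemma enorm_ge0 u : 0 <= enorm u.
Proof. exact: sqrtr_ge0. Qed.

Lemma enorm_sqr u : enorm u ^+ 2 = dot u u.
Proof. by rewrite sqr_sqrtr ?dot_ge0. Qed.

Lemma enorm0 : enorm (0 : 'rV[R]_n) = 0.
Proof. by rewrite /enorm dot0l sqrtr0. Qed.

Lemma enormZ a u : enorm (a *: u) = `|a| * enorm u.
Proof.
by rewrite /enorm !dotE mulrA -expr2 sqrtrM ?sqr_ge0// sqrtr_sqr.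
Qed.

Lemma enormN u : enorm (- u) = enorm u.
Proof. by rewrite -scaleN1r enormZ normrN1 mul1r. Qed.

Lemma enorm_sub u v : enorm (u - v) = enorm (v - u).
Proof. by rewrite -enormN opprB. Qed.

Lemma enorm_eq0 u : enorm u = 0 -> u = 0.
Proof.
move=> u0; have : dot u u == 0 by rewrite -enorm_sqr u0 expr0n.
rewrite psumr_eq0 => [/allP h|i _]; last by rewrite -expr2 sqr_ge0.
apply/rowP => i; have := h i (mem_index_enum i).
by rewrite mulf_eq0 orbb mxE => /eqP.
Qed.

Lemma cauchy_schwarz u v : dot u v <= enorm u * enorm v.
Proof.
have [u0|u0] := eqVneq (enorm u) 0.
  by rewrite (enorm_eq0 u0) dot0l enorm0 mul0r.
have [v0|v0] := eqVneq (enorm v) 0.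
  by rewrite (enorm_eq0 v0) dotC dot0l enorm0 mulr0.
have up : 0 < enorm u by rewrite lt_neqAle eq_sym u0 enorm_ge0.
have vp : 0 < enorm v by rewrite lt_neqAle eq_sym v0 enorm_ge0.
have := dot_ge0 (enorm v *: u - enorm u *: v).
rewrite !dotE -!enorm_sqr (dotC v u).
rewrite [X in 0 <= X](_ : _ =
  enorm u * enorm v * (2 * (enorm u * enorm v - dot u v))); last by ring.
by rewrite pmulr_rge0 ?mulr_gt0// pmulr_rge0 ?subr_ge0.
Qed.

Lemma cauchy_schwarz_abs u v : `|dot u v| <= enorm u * enorm v.
Proof.
rewrite ler_norml cauchy_schwarz andbT lerNl -dotNl.
by rewrite (le_trans (cauchy_schwarz _ _))// enormN.
Qed.

Lemma enormD u v : enorm (u + v) <= enorm u + enorm v.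
Proof.
rewrite -(@ler_pXn2r _ 2)// ?nnegrE ?addr_ge0 ?enorm_ge0//.
rewrite enorm_sqr !dotE -!enorm_sqr (dotC v u).
by have := cauchy_schwarz u v; lra.
Qed.

Lemma enormB_ge u v : enorm u - enorm v <= enorm (u - v).
Proof. by rewrite lerBlDr (le_trans _ (enormD _ _))// subrK. Qed.

Lemma in_ball_diam (S : set 'rV[R]_n) c r x y : in_ball S c r -> S x -> S y ->
  enorm (x - y) <= 2 * r.
Proof.
move=> Sr Sx Sy; have -> : x - y = (x - c) - (y - c) by rewrite opprB addrA subrK.
rewrite (le_trans (enormD _ _))// enormN.
by have := Sr _ Sx; have := Sr _ Sy; lra.
Qed.

(** This lemma and the next three compare Euclidean quantities with the sup norm, in which limits,
    balls and differentiability are expressed. The crude factor [n%:R + 1] replaces the square root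
    of [n] and stays positive for [n = 0]. *)
Lemma coord_le_norm (u : 'rV[R]_n) i : `|u 0 i| <= `|u|.
Proof.
rewrite /Num.norm/= mx_normrE.
exact: (le_bigmax 0 (fun ij : 'I_1 * 'I_n => `|u ij.1 ij.2|) (0, i)).
Qed.

Lemma dot_le_norm u v : `|dot u v| <= n%:R * (`|u| * `|v|).
Proof.
rewrite (le_trans (ler_norm_sum _ _ _))//.
rewrite (_ : n%:R * _ = \sum_(i < n) (`|u| * `|v|)); last first.
  by rewrite sumr_const card_ord mulr_natl.
by apply: ler_sum => i _; rewrite normrM ler_pM// coord_le_norm.
Qed.

Lemma norm_le_enorm u : `|u| <= enorm u.
Proof.
rewrite {1}/Num.norm/= mx_normrE; apply/bigmax_leP; split=> [|[i j] _ /=].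
  exact: enorm_ge0.
rewrite ord1 -(@ler_pXn2r _ 2)// ?nnegrE ?enorm_ge0// enorm_sqr.
rewrite real_normK ?num_real// /dot (bigD1 j)//= -expr2 lerDl sumr_ge0// => k _.
by rewrite -expr2 sqr_ge0.
Qed.

Lemma enorm_le_norm u : enorm u <= (n%:R + 1) * `|u|.
Proof.
rewrite -(@ler_pXn2r _ 2)// ?nnegrE ?enorm_ge0 ?mulr_ge0 ?addr_ge0//.
rewrite enorm_sqr (le_trans (ler_norm _))// (le_trans (dot_le_norm _ _))//.
rewrite exprMn expr2 -expr2 ler_wpM2r ?sqr_ge0//.
by have : 0 <= n%:R :> R by []; nra.
Qed.

End euclidean_space.

Section convexity.
Context {R : realType} {n : nat}.
Implicit Types (S : set 'rV[R]_n) (f : 'rV[R]_n -> R).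

Lemma convex_setP S x y (s : R) : convex_set S -> S x -> S y -> 0 <= s -> s <= 1 ->
  S (x + s *: (y - x)).
Proof.
move=> cS Sx Sy s0 s1; have := cS y x (Itv01 s0 s1).
rewrite !inE => /(_ Sy Sx); rewrite /conv/=/unstable.onem scalerBr scalerBl scale1r.
by rewrite addrCA.
Qed.

Lemma convex_functionP S f x y (s : R) : convex_function S f -> S x -> S y ->
  0 <= s -> s <= 1 -> f (x + s *: (y - x)) <= f x + s * (f y - f x).
Proof.
move=> cf Sx Sy s0 s1.
have : f (s *: y + (1 - s) *: x) <= s * f y + (1 - s) * f x.
  by apply: (cf (Itv01 s0 s1) y x); rewrite inE.
rewrite scalerBl scale1r addrCA -scalerBr => /le_trans; apply.
by rewrite mulrBr mulrBl mul1r addrCA.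
Qed.

End convexity.

(** The mean value theorem is applied to [F] minus the quadratic [c s + K s^2 / 2], whose derivative
    is nonpositive on the segment. *)
Lemma le_quad_of_derive {R : realType} (F dF : R -> R) (c K : R) :
  (forall s : R, 0 <= s -> s <= 1 -> is_derive s (1:R) (F : R -> R^o) (dF s)) ->
  (forall s : R, 0 <= s -> s <= 1 -> dF s <= c + s * K) -> F 1 - F 0 <= c + K / 2.
Proof.
move=> DF le_dF.
pose G : R -> R^o := (F : R -> R^o) - (c *: (id : R -> R^o))
  - (K / 2 *: ((id : R -> R^o) * id)).
have DG (s : R) : 0 <= s -> s <= 1 -> is_derive s (1 : R) G (dF s - c - s * K).
  move=> s0 s1; have D := DF s s0 s1.
  apply: is_derive_eq.
  rewrite /GRing.scale/=; lra.
have [|//|a] := @MVT_segment R G (fun s => dF s - c - s * K) 0 1 ler01.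
- by move=> s; rewrite in_itv/= => /andP[s0 s1]; apply: DG; exact: ltW.
- apply: derivable_within_continuous => s; rewrite in_itv/= => /andP[s0 s1].
  by have [] := DG s s0 s1.
rewrite in_itv/= => /andP[a0 a1]; have := le_dF a a0 a1.
rewrite /G !fctE /GRing.scale /=; lra.
Qed.

Section calculus.
Context {R : realType} {n : nat}.
Implicit Types (S : set 'rV[R]_n) (f : 'rV[R]_n -> R) (x v : 'rV[R]_n).

Lemma derive_grad f x v : differentiable (f : 'rV[R]_n -> R^o) x ->
  'D_v (f : 'rV[R]_n -> R^o) x = dot (grad f x) v.
Proof.
move=> df; rewrite deriveE// {1}(row_sum_delta v) linear_sum.
by apply: eq_bigr => i _; rewrite linearZ /= mxE deriveE// mulrC.
Qed.

Lemma is_derive_line f x v (s : R) :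
  differentiable (f : 'rV[R]_n -> R^o) (x + s *: v) ->
  is_derive s 1 (fun r : R => f (x + r *: v) : R^o) (dot (grad f (x + s *: v)) v).
Proof.
move=> df.
have [dl dlE] : is_diff s (cst x + *:%R^~ v : R -> 'rV[R]_n) (0 + *:%R^~ v).
  exact: is_diffD.
have dfl : differentiable ((f : _ -> R^o) \o (cst x + *:%R^~ v : R -> 'rV[R]_n)) s.
  by apply: differentiable_comp.
split; first exact: diff_derivable.
rewrite (_ : (fun r => _) = (f : _ -> R^o) \o (cst x + *:%R^~ v : R -> 'rV[R]_n))//.
rewrite deriveE// diff_comp//.
by rewrite /= dlE /= add0r scale1r -deriveE// derive_grad.
Qed.

Lemma mvt_line f x y :
  (forall s : R, 0 <= s -> s <= 1 ->
    differentiable (f : 'rV[R]_n -> R^o) (x + s *: (y - x))) ->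
  exists s, [/\ 0 <= s, s <= 1 &
    f y - f x = dot (grad f (x + s *: (y - x))) (y - x)].
Proof.
move=> df.
have [|//|c] := @MVT_segment R (fun r => f (x + r *: (y - x)))
    (fun s => dot (grad f (x + s *: (y - x))) (y - x)) 0 1 ler01.
- by move=> s; rewrite in_itv/= => /andP[s0 s1]; apply/is_derive_line/df; exact: ltW.
- apply: derivable_within_continuous => s; rewrite in_itv/= => /andP[s0 s1].
  by have [] := is_derive_line (df s s0 s1).
rewrite in_itv/= => /andP[c0 c1] E; exists c; split => //.
by move: E; rewrite scale1r scale0r addr0 subr0 mulr1 subrKC.
Qed.

(** The hypotheses concern the segment from [x] to [y] alone, so that the estimate can be used on
    any convex set that contains both points. *)
Lemma descent f x y L :
  (forall s : R, 0 <= s -> s <= 1 ->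
    differentiable (f : 'rV[R]_n -> R^o) (x + s *: (y - x))) ->
  (forall s : R, 0 <= s -> s <= 1 ->
    enorm (grad f (x + s *: (y - x)) - grad f x) <= L * (s * enorm (y - x))) ->
  `|f y - f x - dot (grad f x) (y - x)| <= L / 2 * enorm (y - x) ^+ 2.
Proof.
move=> df lip; set v := y - x.
(* Both signs are treated at once by a factor [e] of absolute value 1. *)
suff H e : `|e| = 1 -> e * (f y - f x - dot (grad f x) v) <= L / 2 * enorm v ^+ 2.
  rewrite ler_norml -(mul1r (f y - _ - _)) H ?normr1// andbT.
  by rewrite lerNl -mulN1r mul1r H// normrN1.
move=> e1.
have := @le_quad_of_derive R (fun s => e * f (x + s *: v))
  (fun s => e * dot (grad f (x + s *: v)) v) (e * dot (grad f x) v) (L * enorm v ^+ 2).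
rewrite scale1r scale0r addr0 /v subrKC -/v => H.
suff : e * f y - e * f x <= e * dot (grad f x) v + L * enorm v ^+ 2 / 2 by lra.
apply: H => s s0 s1.
  by have D := is_derive_line (df s s0 s1); exact: (is_deriveZ _ _).
rewrite -lerBlDl -mulrBr -dotNl -dotDl (le_trans (ler_norm _))// normrM e1 mul1r.
rewrite (le_trans (cauchy_schwarz_abs _ _))//.
have := ler_wpM2r (enorm_ge0 v) (lip s s0 s1); rewrite -/v => /le_trans; apply.
by rewrite le_eqVlt; apply/orP; left; apply/eqP; ring.
Qed.

Lemma convex_grad_le S f x y : convex_function S f ->
  differentiable (f : 'rV[R]_n -> R^o) x -> S x -> S y ->
  dot (grad f x) (y - x) <= f y - f x.
Proof.
move=> cf df Sx Sy; rewrite -derive_grad//.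
have := @diff_derivable _ _ _ _ _ (y - x) df => /cvg_ex[l cl].
have lE : 'D_(y - x) (f : 'rV[R]_n -> R^o) x = l by apply/cvg_lim.
(* Convexity bounds the difference quotient for steps in []0, 1]], so the limit is restricted to
   positive steps. *)
rewrite lE; have {}cl : h^-1 * (f (h *: (y - x) + x) - f x) @[h --> (0 : R)^'+] --> l.
  apply: cvg_trans cl => A /= [e e0 H]; exists e => // h eh h0.
  by apply: H => //; rewrite gt_eqF.
rewrite -(cvg_lim _ cl)//; apply: limr_le; first by apply/cvg_ex; exists l.
near=> h; have h0 : 0 < h by near: h; exact: nbhs_right_gt.
rewrite ler_pdivrMl// lerBlDl [h *: _ + x]addrC.
apply: (convex_functionP cf Sx Sy); first exact: ltW.
by near: h; exact: nbhs_right_le.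
Unshelve. all: by end_near. Qed.

End calculus.

(** * The regularized inner problem *)

Section strong_convexity.
Context {R : realType} {n : nat}.
Implicit Types (S : set 'rV[R]_n) (f m : 'rV[R]_n -> R) (x y z : 'rV[R]_n).

(** This exact identity is the source of the moduli of strong convexity below, both for the
    regularizer and for the proximal models. *)
Lemma enorm_sqr_line x y z (s : R) : enorm (x + s *: (y - x) - z) ^+ 2 =
  (1 - s) * enorm (x - z) ^+ 2 + s * enorm (y - z) ^+ 2
  - s * (1 - s) * enorm (y - x) ^+ 2.
Proof.
have -> : y - x = (y - z) - (x - z) by rewrite opprB addrA subrK.
rewrite addrAC !enorm_sqr; move: (x - z) (y - z) => u v.
rewrite !dotE (dotC v u); ring.
Qed.

Lemma enorm_sqrD x y : enorm (x + y) ^+ 2 = enorm x ^+ 2 + 2 * dot x y + enorm y ^+ 2.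
Proof. rewrite !enorm_sqr !dotE (dotC y x); ring. Qed.

(** This is the passage to the limit [s = 0]. If [a < b], the choice [s = (b - a) / (2 b)] makes the
    left side the mean of [a] and [b], which exceeds [a]. *)
Lemma ge_of_forall_scaled (a b : R) :
  (forall s, 0 < s -> s <= 1 -> (1 - s) * b <= a) -> b <= a.
Proof.
move=> H; have a0 : 0 <= a by have := H 1 ltr01 (lexx _); rewrite subrr mul0r.
rewrite leNgt; apply/negP => ab; have b0 := le_lt_trans a0 ab.
have := H ((b - a) / (2 * b)).
rewrite divr_gt0 ?subr_gt0 ?mulr_gt0// ler_pdivrMr ?mulr_gt0//.
have -> : (1 - (b - a) / (2 * b)) * b = (a + b) / 2 by field; rewrite gt_eqF.
by move=> /(_ isT); lra.
Qed.

(** Minimality of [x] against [x + s (y - x)] leaves [(1 - s) c / 2 |y - x|^2 <= m y - m x] after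
    division by [s]; then [s] tends to 0. *)
Lemma argmin_strong S m (c : R) x y : convex_set S ->
  is_argmin S m x -> S y ->
  (forall s, 0 <= s -> s <= 1 -> m (x + s *: (y - x)) <=
    m x + s * (m y - m x) - c / 2 * (s * (1 - s)) * enorm (y - x) ^+ 2) ->
  m x + c / 2 * enorm (y - x) ^+ 2 <= m y.
Proof.
move=> cS [Sx minx] Sy sc; rewrite -lerBrDl; apply: ge_of_forall_scaled => s s0 s1.
have := le_trans (minx _ (convex_setP cS Sx Sy (ltW s0) s1)) (sc s (ltW s0) s1).
move=> H; rewrite -(ler_pM2l s0); lra.
Qed.

End strong_convexity.

Section regularization.
Context {R : realType} {n : nat}.
Implicit Types (f : 'rV[R]_n -> R) (a v : 'rV[R]_n).

Lemma is_derive_quadratic (c0 c1 c2 : R) :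
  is_derive (0 : R) (1 : R) (fun s : R => c0 + c1 * s + c2 * s ^+ 2 : R^o) c1.
Proof.
rewrite (_ : (fun s : R => _) = (cst c0 : R -> R^o) + (c1 *: (id : R -> R^o))
  + (c2 *: ((id : R -> R^o) * id))); last by apply/funext.
have D1 := @is_derive_id R R^o 0 1.
have D2 := is_deriveM D1 D1.
have D3 := is_deriveD (is_deriveD (is_derive_cst (c0 : R^o) (0 : R) 1)
  (is_deriveZ c1 D1)) (is_deriveZ c2 D2).
apply: (is_derive_eq D3).
by rewrite /GRing.scale/=; ring.
Qed.

(** Along the line through [a] with direction [v] the function is a quadratic polynomial in the
    parameter, and its linear coefficient is the derivative. *)
Lemma is_derive_sqr_dist (c : R) b a v :
  is_derive a v ((fun z => c * enorm (z - b) ^+ 2) : 'rV[R]_n -> R^o) (2 * c * dot (a - b) v).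
Proof.
have D := is_derive_quadratic (c * enorm (a - b) ^+ 2) (2 * c * dot (a - b) v) (c * enorm v ^+ 2).
rewrite (_ : (fun s => _) = fun s : R => c * enorm (s *: v + a - b) ^+ 2 : R^o) in D; last first.
  apply/funext => s; have -> : s *: v + a - b = (a - b) + s *: v by rewrite -addrA addrC.
  rewrite (enorm_sqrD (a - b)) enormZ dotZr exprMn real_normK ?num_real//; ring.
split; first by apply/derivable1P; case: D.
have [_ <-] := D; rewrite /derive; apply: (congr1 (fun g : R -> R^o => lim (g @ 0^'))).
by apply/funext => s /=; rewrite addr0 scale0r add0r [_%:A]mulr1.
Qed.

Lemma grad_reg f (l : R) b a : differentiable (f : 'rV[R]_n -> R^o) a ->
  grad (fun z => f z - l / 2 * enorm (z - b) ^+ 2) a = grad f a - l *: (a - b).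
Proof.
move=> df; apply/rowP => i; rewrite !mxE.
have D := is_derive_sqr_dist (l / 2) b a (delta_mx 0 i).
have Df : is_derive a (delta_mx 0 i) (f : 'rV[R]_n -> R^o)
    ('D_(delta_mx 0 i) (f : 'rV[R]_n -> R^o) a).
  by apply: derivableP; exact: diff_derivable.
have [_ ->] := is_deriveB Df D; congr (_ - _).
by rewrite dot_delta !mxE; field.
Qed.

End regularization.

Section prox_gradient.
Context {R : realType} {n : nat}.
Variables (Al E : set 'rV[R]_n) (f p : 'rV[R]_n -> R) (b : 'rV[R]_n) (l L22 : R).
Hypothesis cAl : convex_set Al.
Hypothesis cE : convex_set E.
Hypothesis AlE : Al `<=` E.
Hypothesis df : forall a, differentiable (f : 'rV[R]_n -> R^o) a.
Hypothesis concf : convex_function E (fun a => - f a).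
Hypothesis lipf : forall a1 a2, E a1 -> E a2 ->
  enorm (grad f a1 - grad f a2) <= L22 * enorm (a1 - a2).
Hypothesis cp : convex_function Al p.
Hypothesis l_gt0 : 0 < l.

Let H a := f a - l / 2 * enorm (a - b) ^+ 2.
Let F a := H a - p a.

Lemma concave_grad_ge x y : E x -> E y -> f y - f x <= dot (grad f x) (y - x).
Proof.
move=> Ex Ey; have dN : differentiable ((fun a => - f a) : 'rV[R]_n -> R^o) x.
  exact: differentiableN.
have := convex_grad_le concf dN Ex Ey.
have -> : grad (fun a => - f a) x = - grad f x.
  apply/rowP => i; rewrite !mxE; apply: deriveN; exact: diff_derivable.
by rewrite dotNl; lra.
Qed.

(** The regularizer equals its second order expansion at [x], so its quadratic term is added to the
    tangent inequality of [f]. In the next lemma the same expansion adds [l] to the curvature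
    [L22]. *)
Lemma reg_concave_ub x y : E x -> E y ->
  H y <= H x + dot (grad H x) (y - x) - l / 2 * enorm (y - x) ^+ 2.
Proof.
move=> Ex Ey; rewrite grad_reg// dotDl dotNl dotZl /H.
have := concave_grad_ge Ex Ey; have -> : y - b = (x - b) + (y - x) by rewrite [RHS]addrC subrKA.
by rewrite (enorm_sqrD (x - b)); lra.
Qed.

Lemma reg_descent_lb x y : E x -> E y ->
  H x + dot (grad H x) (y - x) - (L22 + l) / 2 * enorm (y - x) ^+ 2 <= H y.
Proof.
move=> Ex Ey; rewrite grad_reg// dotDl dotNl dotZl /H.
have : `|f y - f x - dot (grad f x) (y - x)| <= L22 / 2 * enorm (y - x) ^+ 2.
  apply: descent => // s s0 s1.
  rewrite (le_trans (lipf _ _))//; first exact: convex_setP.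
  by rewrite addrAC subrr add0r enormZ ger0_norm.
rewrite ler_norml => /andP[+ _].
have -> : y - b = (x - b) + (y - x) by rewrite [RHS]addrC subrKA.
by rewrite (enorm_sqrD (x - b)); lra.
Qed.

Lemma reg_strong_concave x y s : Al x -> Al y -> 0 <= s -> s <= 1 ->
  F x + s * (F y - F x) + l / 2 * (s * (1 - s)) * enorm (y - x) ^+ 2
  <= F (x + s *: (y - x)).
Proof.
move=> Ax Ay s0 s1; rewrite /F /H.
have := convex_functionP concf (AlE Ax) (AlE Ay) s0 s1.
have := convex_functionP cp Ax Ay s0 s1.
rewrite enorm_sqr_line; lra.
Qed.

Lemma reg_concave x y s : Al x -> Al y -> 0 <= s -> s <= 1 ->
  F x + s * (F y - F x) <= F (x + s *: (y - x)).
Proof.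
move=> Ax Ay s0 s1; apply: le_trans (reg_strong_concave Ax Ay s0 s1).
by rewrite lerDl !mulr_ge0 ?subr_ge0 ?exprn_ge0 ?enorm_ge0// ltW.
Qed.

Lemma reg_argmax_strong x y : is_argmax Al F x -> Al y ->
  l / 2 * enorm (y - x) ^+ 2 <= F x - F y.
Proof.
move=> [Ax maxx] Ay.
have := @argmin_strong _ _ Al (fun a => - F a) l x y cAl.
have H1 : is_argmin Al (fun a => - F a) x by split=> // z Az; rewrite lerN2 maxx.
move=> /(_ H1 Ay) H2; suff : - F x + l / 2 * enorm (y - x) ^+ 2 <= - F y by lra.
by apply: H2 => s s0 s1; have := reg_strong_concave Ax Ay s0 s1; lra.
Qed.

(** Three inequalities are added: the proximal model is strongly convex with modulus [L22 + l] and
    minimal at [x], [H x] is bounded below by the descent lemma at [y], and [H a] is bounded above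
    by concavity at [y]. The point [y] need only lie in [E]. *)
Lemma prox_gradient_ineq x y a : E y -> Al a -> 0 < L22 ->
  is_argmax Al (fun z => dot (grad H y) (z - y)
    - (2 * (L22 + l)^-1)^-1 * enorm (z - y) ^+ 2 - p z) x ->
  F a - F x <= (L22 + l) / 2 * (enorm (a - y) ^+ 2 - enorm (a - x) ^+ 2).
Proof.
move=> Ey Aa L0 [Ax maxx]; set L := L22 + l.
have E2 : (2 * L^-1)^-1 = L / 2 by rewrite invfM invrK mulrC.
pose m z := - (dot (grad H y) (z - y) - L / 2 * enorm (z - y) ^+ 2 - p z).
have : m x + L / 2 * enorm (a - x) ^+ 2 <= m a.
  apply: (@argmin_strong _ _ Al m L x a cAl) => //.
    by split=> // z Az; rewrite lerN2 -E2 maxx.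
  move=> s s0 s1; rewrite /m enorm_sqr_line.
  have -> : x + s *: (a - x) - y = (x - y) + s *: ((a - y) - (x - y)).
    by rewrite addrAC opprB addrA subrK.
  have := convex_functionP cp Ax Aa s0 s1; rewrite !dotE; lra.
have := reg_descent_lb Ey (AlE Ax); have := reg_concave_ub Ey (AlE Aa).
have : 0 <= l / 2 * enorm (a - y) ^+ 2.
  by rewrite !mulr_ge0 ?exprn_ge0 ?enorm_ge0// ltW.
by rewrite /m /F -/L; lra.
Qed.

End prox_gradient.

(** * Accelerated proximal gradient rounds *)

Section acceleration.
Context {R : realType} {n : nat}.

Lemma beta1 : beta 1 = 1 :> R.
Proof. by []. Qed.

Lemma betaS j : (0 < j)%N ->
  beta j.+1 = (1 + Num.sqrt (1 + 4 * beta j ^+ 2)) / 2 :> R.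
Proof. by case: j. Qed.

(** By its definition, [beta j.+1] is the larger root of [b^2 - b = beta j ^+ 2]. *)
Lemma beta_rec j : (0 < j)%N -> beta j.+1 ^+ 2 - beta j.+1 = beta j ^+ 2 :> R.
Proof.
move=> j0; rewrite betaS//.
have : Num.sqrt (1 + 4 * beta j ^+ 2) ^+ 2 = 1 + 4 * beta j ^+ 2 :> R.
  by rewrite sqr_sqrtr// addr_ge0// mulr_ge0// sqr_ge0.
move: (Num.sqrt _) => s; move: (beta j) => b; lra.
Qed.

(** As [sqrt (1 + 4 b^2) >= 2 b], each step adds at least 1/2. *)
Lemma beta_ge j : (0 < j)%N -> (j.+1)%:R / 2 <= beta j :> R.
Proof.
elim: j => // -[_ _|j IH _]; first by rewrite beta1 divff.
have {IH} := IH isT; rewrite [beta j.+2]betaS//; move: (beta j.+1) => b.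
rewrite -[(j.+3)%:R]natr1; have j0 : 0 <= (j.+2)%:R :> R by []; move: j0.
move: (_%:R) => c c0 cb.
suff : 2 * b <= Num.sqrt (1 + 4 * b ^+ 2) by lra.
have b0 : 0 <= b by lra.
rewrite -[leLHS]ger0_norm ?mulr_ge0// -sqrtr_sqr ler_wsqrtr// exprMn.
by rewrite -natrX lerDr.
Qed.

Lemma fista_rate (Al : set 'rV[R]_n) (F : 'rV[R]_n -> R) (L : R) (N : nat)
    (x y : nat -> 'rV[R]_n) z :
  (forall a b s, Al a -> Al b -> 0 <= s -> s <= 1 ->
    Al (a + s *: (b - a)) /\ F a + s * (F b - F a) <= F (a + s *: (b - a))) ->
  (0 < N)%N -> 0 <= L -> Al z ->
  (forall j, (1 <= j <= N)%N -> Al (x j)) ->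
  (forall j a, (1 <= j <= N)%N -> Al a ->
    F a - F (x j) <= L / 2 * (enorm (a - y j) ^+ 2 - enorm (a - x j) ^+ 2)) ->
  (forall j, (1 <= j < N)%N ->
    y j.+1 = x j + ((beta j - 1) / beta j.+1) *: (x j - x j.-1)) ->
  (N%:R + 1) ^+ 2 * (F z - F (x N)) <= 2 * L * enorm (y 1%N - z) ^+ 2.
Proof.
move=> conc N0 L0 Az Ax prox yE.
(* Beck and Teboulle's potential [beta_j^2 (F z - F x_j) + L/2 |u_j|^2] is
   nonincreasing: apply [prox] to the average of [x_(j-1)] and [z] with weight
   [1 / beta_j] on [z]. *)
pose u j := beta j *: x j - (beta j - 1) *: x j.-1 - z.
have main j : (1 <= j <= N)%N ->
    beta j ^+ 2 * (F z - F (x j)) + L / 2 * enorm (u j) ^+ 2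
    <= L / 2 * enorm (y 1%N - z) ^+ 2.
  elim: j => // -[_ N1|j IH /andP[_ jN]].
    (* Since [beta 1 = 1], the point [x 0] drops out of [u 1]: a round depends on its start through
       [y 1] alone, although [x 0] is reset in every round. *)
    have := prox 1%N z N1 Az.
    rewrite /u beta1 subrr scale1r scale0r subr0 !(enorm_sub z); lra.
  have jN' : (1 <= j.+1 <= N)%N by rewrite (ltnW jN).
  apply: le_trans (IH jN') => {IH}.
  have b0 : 0 < beta j.+2 :> R by apply: lt_le_trans (beta_ge _).
  have b1 : 1 <= beta j.+2 :> R.
    by apply: le_trans (beta_ge _) => //; rewrite ler_pdivlMr// mul1r ler_nat.
  set b := beta j.+2 in b0 b1 *.
  pose a := x j.+1 + b^-1 *: (z - x j.+1).
  have [] := conc (x j.+1) z b^-1 (Ax _ jN') Az; rewrite ?invr_ge0 ?(ltW b0) ?invf_le1//.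
  rewrite -/a => Aa Fa; have := prox j.+2 a jN Aa.
  (* The extrapolation is designed so that [u j.+2] and [u j.+1] are the same multiple of the
     differences of [a] with [x j.+2] and [y j.+2]. Hence [b^2] times the proximal inequality
     compares consecutive potentials. *)
  have ub : u j.+2 = - (b *: (a - x j.+2)).
    rewrite /u /a -/b; apply/rowP => i; rewrite !mxE; field.
    by rewrite gt_eqF.
  have uy : u j.+1 = - (b *: (a - y j.+2)).
    rewrite yE// /u /a -/b; apply/rowP => i; rewrite !mxE; field.
    by rewrite gt_eqF.
  rewrite ub uy !enormN !enormZ !(exprMn _ `|b|) real_normK ?num_real//.
  have := beta_rec (ltn0Sn j) : beta j.+2 ^+ 2 - beta j.+2 = beta j.+1 ^+ 2 :> R.
  rewrite -/b => <- P.
  have : b ^+ 2 * (F (x j.+1) + b^-1 * (F z - F (x j.+1)) - F (x j.+2)) <=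
    b ^+ 2 * (L / 2 * (enorm (a - y j.+2) ^+ 2 - enorm (a - x j.+2) ^+ 2)).
    by rewrite ler_pM2l ?exprn_gt0//; lra.
  rewrite [X in X <= _](_ : _ = b ^+ 2 * F (x j.+1) + b * (F z - F (x j.+1))
    - b ^+ 2 * F (x j.+2)); last first.
    by field; rewrite gt_eqF.
  lra.
have NN : (1 <= N <= N)%N by rewrite N0 leqnn.
have := main N NN; have := beta_ge N0; rewrite -natr1.
have : 0 <= L / 2 * enorm (u N) ^+ 2 by rewrite !mulr_ge0 ?exprn_ge0 ?enorm_ge0.
have c0 : 0 <= N%:R :> R by []; move: c0.
have d0 : 0 <= L / 2 * enorm (y 1%N - z) ^+ 2 by rewrite !mulr_ge0 ?exprn_ge0 ?enorm_ge0.
move=> c0 u0 cb {}main.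
(* Replacing [beta N ^+ 2] by its lower bound requires a nonnegative gap; for a negative gap the
   claim is immediate. *)
have [v0|v0] := leP 0 (F z - F (x N)); last first.
  apply: (@le_trans _ _ 0); last by lra.
  by rewrite mulr_ge0_le0 ?sqr_ge0// ltW.
have : (N%:R + 1) ^+ 2 * (F z - F (x N)) <= 4 * beta N ^+ 2 * (F z - F (x N)).
  by rewrite ler_wpM2r//; nra.
lra.
Qed.

End acceleration.

(** * Danskin's theorem *)

Section attainment.
Context {R : realType} {n : nat}.
Implicit Types (S : set 'rV[R]_n) (f : 'rV[R]_n -> R).

Lemma maxval_argmax S f x : is_argmax S f x -> maxval S f = f x.
Proof.
move=> [Sx fx]; apply/eqP; rewrite eq_le; apply/andP; split.
  by apply: ge_sup; [exists (f x), x|move=> _ [y Sy <-]; exact: fx].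
apply: ub_le_sup; last by exists x.
by exists (f x) => _ [y Sy <-]; exact: fx.
Qed.

Lemma maxval_le S f c : S !=set0 -> (forall x, S x -> f x <= c) -> maxval S f <= c.
Proof.
move=> [x Sx] fc; apply: ge_sup; first by exists (f x), x.
by move=> _ [y Sy <-]; exact: fc.
Qed.

Lemma minval_ge S f c : S !=set0 -> (forall x, S x -> c <= f x) -> c <= minval S f.
Proof.
move=> [x Sx] fc; apply: lb_le_inf; first by exists (f x), x.
by move=> _ [y Sy <-]; exact: fc.
Qed.

Lemma minval_le S f c x : (forall x, S x -> c <= f x) -> S x -> minval S f <= f x.
Proof.
move=> fc Sx; apply: ge_inf; last by exists x.
by exists c => _ [y Sy <-]; exact: fc.
Qed.

Lemma lipschitz_within S f (K : R) : 0 <= K ->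
  (forall x y, S x -> S y -> `|f x - f y| <= K * enorm (x - y)) ->
  {within S, continuous (f : 'rV[R]_n -> R^o)}.
Proof.
move=> K0 lip; apply/subspace_continuousP => x Sx.
apply/cvgrPdist_le => e e0; pose d := e / ((K + 1) * (n%:R + 1)).
have n1 : 0 < n%:R + 1 :> R by rewrite ltr_wpDl.
have d0 : 0 < d by rewrite divr_gt0 ?mulr_gt0// ltr_wpDl.
apply/nbhs_ballP; exists d => // y; rewrite -ball_normE /= => xy Sy.
rewrite (le_trans (lip _ _ Sx Sy))// (@le_trans _ _ ((K + 1) * ((n%:R + 1) * d)))//.
  rewrite ler_pM ?enorm_ge0 ?lerDl//.
  by rewrite (le_trans (enorm_le_norm _))// ler_wpM2l// ltW.
by rewrite /d le_eqVlt; apply/orP; left; apply/eqP; field; rewrite !gt_eqF// ltr_wpDl.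
Qed.

Lemma differentiable_within S f : (forall x, S x -> differentiable (f : 'rV[R]_n -> R^o) x) ->
  {within S, continuous (f : 'rV[R]_n -> R^o)}.
Proof.
move=> df; apply: continuous_in_subspaceT => x; rewrite inE => Sx.
exact/differentiable_continuous/df.
Qed.

Lemma withinB S f g : {within S, continuous (f : 'rV[R]_n -> R^o)} ->
  {within S, continuous (g : 'rV[R]_n -> R^o)} ->
  {within S, continuous (fun x => f x - g x : R^o)}.
Proof. by move=> cf cg x; apply: cvgB; [exact: cf|exact: cg]. Qed.

Lemma differentiable_sqr_dist (c : R) (b x : 'rV[R]_n) :
  differentiable (fun z => c * enorm (z - b) ^+ 2 : R^o) x.
Proof.
have -> : (fun z => c * enorm (z - b) ^+ 2 : R^o) =
   c *: (\sum_(i < n) ((fun z : 'rV[R]_n => z 0 i : R^o) - cst (b 0 i))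
     * ((fun z : 'rV[R]_n => z 0 i : R^o) - cst (b 0 i))).
  apply/funext => z; rewrite enorm_sqr fctE fct_sumE; congr (_ * _).
  by apply: eq_bigr => i _; rewrite !mxE.
apply/differentiableZ/differentiable_sum => i.
by apply: differentiableM; apply: differentiableB => //; exact: differentiable_coord.
Qed.

Lemma argmax_exists S f : S !=set0 -> compact S ->
  {within S, continuous (f : 'rV[R]_n -> R^o)} -> exists x, is_argmax S f x.
Proof.
move=> S0 cS cf; have [x] := compact_EVT_max S0 cS cf.
by rewrite inE => Sx fx; exists x; split => // y Sy; apply: fx; rewrite inE.
Qed.

End attainment.

Section gradient_characterization.
Context {R : realType} {n : nat}.
Variable G : 'rV[R]_n.

(** The map [dot G] is made a continuous linear map, so that it can be identified with the
    differential by uniqueness. *)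
Let dotG (v : 'rV[R]_n) : R^o := dot G v.
Let dotG_linear : linear dotG.
Proof. by move=> a u v; rewrite /dotG !dotE. Qed.
HB.instance Definition _ := GRing.isLinear.Build R 'rV[R]_n R^o _ dotG dotG_linear.

Let dotG_continuous : continuous dotG.
Proof.
apply: bounded_linear_continuous; exists (n%:R * `|G|); split => [|M HM]; first exact: num_real.
near=> v; rewrite /= (le_trans (dot_le_norm _ _))// (le_trans _ (ltW HM))//.
rewrite mulrA ler_piMr ?mulr_ge0//; near: v; apply/nbhs_ballP; exists 1 => //= v.
Unshelve. all: by end_near. Qed.

Lemma differentiable_of_dot (g : 'rV[R]_n -> R) t :
  (forall e : R, 0 < e -> \forall v \near (0 : 'rV[R]_n),
     `|g (v + t) - g t - dot G v| <= e * `|v|) ->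
  differentiable (g : 'rV[R]_n -> R^o) t /\ grad g t = G.
Proof.
move=> H.
pose gs : 'rV[R]_n -> R^o := (g : 'rV[R]_n -> R^o) \o shift t.
pose k : 'rV[R]_n -> R^o := cst (g t : R^o) + dotG.
have E : gs = k +o_ (0 : 'rV[R]_n) id.
  apply/eqaddoP => e e0; have := H e e0; apply: filter_app; near=> v.
  by rewrite !fctE /= opprD addrA.
have dE := diff_unique dotG_continuous E.
have dg : differentiable (g : 'rV[R]_n -> R^o) t.
  by apply/diff_locallyP; rewrite dE.
split => //; apply/rowP => i; rewrite mxE deriveE// dE.
exact: dot_delta.
Unshelve. all: by end_near. Qed.

End gradient_characterization.

Section envelope.
Context {R : realType} {m n : nat}.
Variables (Th : set 'rV[R]_m) (Al : set 'rV[R]_n).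
Variables (h : 'rV[R]_m -> 'rV[R]_n -> R) (p : 'rV[R]_n -> R) (q : 'rV[R]_m -> R).
Variables (rad L11 L22 L12 Lp : R) (E : set 'rV[R]_n) (b : 'rV[R]_n) (l : R).
Hypothesis std : standing Th Al h p q rad L11 L22 L12 Lp.
Hypothesis cdom : concave_domain Th Al h L22 E.
Hypothesis Alb : Al b.
Hypothesis l_gt0 : 0 < l.

Let F t a := h_reg h b l t a - p a.
Let g := g_reg Al h p b l.

Lemma diff_th t a : differentiable ((h ^~ a) : 'rV[R]_m -> R^o) t.
Proof. by case: (C1_h std) => H _ _ _; exact: H. Qed.

Lemma diff_al t a : differentiable (h t : 'rV[R]_n -> R^o) a.
Proof. by case: (C1_h std) => _ H _ _; exact: H. Qed.

Lemma reg_argmax_exists t : exists a, is_argmax Al (F t) a.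
Proof.
apply: argmax_exists; [by exists b|exact: (compact_Al std)|].
apply: withinB; last exact: (lipschitz_within (Lp_ge0 std) (lip_p std)).
apply: withinB; apply: differentiable_within => x _; first exact: diff_al.
exact: differentiable_sqr_dist.
Qed.

Lemma g_reg_argmax t a : is_argmax Al (F t) a -> g t = F t a.
Proof. exact: maxval_argmax. Qed.

Lemma g_reg_ge t a : Al a -> F t a <= g t.
Proof.
by move=> Ala; have [x ax] := reg_argmax_exists t; rewrite (g_reg_argmax ax); apply: ax.2.
Qed.

Lemma h_reg_argmax_strong t x a : Th t -> is_argmax Al (F t) x -> Al a ->
  l / 2 * enorm (a - x) ^+ 2 <= F t x - F t a.
Proof.
move=> Tht; exact: (@reg_argmax_strong R n Al E (h t) p b l (convex_Al std)
  (sub_Al_E cdom) (concave_h cdom Tht) (convex_p std)).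
Qed.

(** Neither the regularizer nor [p] depends on theta, so the increments of [F] in theta are those of
    [h]. *)
Lemma h_mvt_th t v a : exists2 s, 0 <= s <= 1 &
  F (t + v) a - F t a = dot (grad_th h (t + s *: v) a) v.
Proof.
have [s [s0 s1]] := @mvt_line _ _ (h ^~ a) t (t + v) (fun s _ _ => diff_th _ _).
have -> : t + v - t = v by rewrite addrC addKr.
by move=> H; exists s; [rewrite s0|rewrite /F /h_reg /grad_th -H; ring].
Qed.

Lemma grad_th_cont t a e : 0 < e -> exists2 d, 0 < d & forall s a',
  `|t - s| < d -> `|a - a'| < d -> `|grad_th h t a - grad_th h s a'| < e.
Proof.
move=> e0; case: (C1_h std) => _ _ /(_ (t, a)) /cvgrPdist_lt /(_ e e0) + _.
move=> /nbhs_ballP[d /= d0 H]; exists d => // s a' ts aa'.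
by apply: (H (s, a')); split; rewrite /= -ball_normE.
Qed.

(** At [t] itself the bound [M - 1] follows from the Lipschitz property in alpha. Points [s] near
    [t] may lie outside [Th], so the bound is extended by joint continuity and compactness of [Al],
    which costs the summand 1. *)
Lemma grad_th_bounded t : Th t -> exists2 M, 0 < M & \forall s \near t,
  forall a, Al a -> `|grad_th h s a| <= M.
Proof.
move=> Tht; pose M := enorm (grad_th h t b) + L12 * (2 * rad) + 1.
have M0 a : Al a -> `|grad_th h t a| <= M - 1.
  move=> Ala; rewrite (le_trans (norm_le_enorm _))// /M addrK.
  rewrite -[grad_th h t a](subrK (grad_th h t b)) addrC (le_trans (enormD _ _))//.
  rewrite lerD2l (le_trans (lip21 std Tht Ala Alb))// ler_pM2l ?(L12_gt0 std)//.
  by have [c Bc] := ball_Al std; exact: in_ball_diam Bc Ala Alb.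
exists M.
  by rewrite /M ltr_wpDl// addr_ge0 ?enorm_ge0// !mulr_ge0// ltW ?(L12_gt0 std) ?(rad_gt0 std).
have /compact_near_coveringP := compact_Al std.
move=> /(_ _ (nbhs t) (fun s a => `|grad_th h s a| <= M) _); apply => a Ala.
have [d d0 H] := @grad_th_cont t a 1 ltr01.
exists (ball a d, ball t d); first by split; exact: nbhsx_ballx.
move=> [a' s] [/=]; rewrite -!ball_normE /= => aa' ts.
have := ltW (H s a' ts aa'); have := M0 a Ala.
rewrite distrC => H1 H2; rewrite -[grad_th h s a'](subrK (grad_th h t a)).
by rewrite (le_trans (ler_normD _ _))//; lra.
Qed.

(* A maximizer [y] at [t + v] tends to [x] by strong concavity, and
   [g (t + v) - g t] lies between the increments of [F] at [x] and at [y]. *)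
Lemma g_reg_diff t x : Th t -> is_argmax Al (F t) x ->
  differentiable (g : 'rV[R]_m -> R^o) t /\ grad g t = grad_th h t x.
Proof.
move=> Tht ax; apply: differentiable_of_dot => e e0.
pose e' := e / (m%:R + 1); have m1 : 0 < m%:R + 1 :> R by rewrite ltr_wpDl.
have e'0 : 0 < e' by rewrite divr_gt0.
have [d d0 Hd] := @grad_th_cont t x e' e'0.
have [M M0 /nbhs_ballP[r /= r0 Hr]] := grad_th_bounded Tht.
(* The entries [r] and [d] keep [t + s v] where the gradient is bounded and close to its value at
   [(t, x)]; the last entry makes strong concavity force [|x - y| < d]. *)
pose rho := Num.min (Num.min r d) (l * d ^+ 2 / (4 * (m%:R + 1) * M)).
have rho0 : 0 < rho.
  by rewrite !lt_min r0 d0 divr_gt0 ?mulr_gt0 ?exprn_gt0.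
have small s v : 0 <= s <= 1 -> `|v| < rho -> `|t - (t + s *: v)| < rho.
  move=> /andP[s0 s1] vr; rewrite opprD addNKr normrN normrZ ger0_norm//.
  by rewrite (le_lt_trans _ vr)// ler_piMl.
have dotM s v a : 0 <= s <= 1 -> `|v| < rho -> Al a ->
    `|dot (grad_th h (t + s *: v) a) v| <= (m%:R + 1) * M * `|v|.
  move=> s01 vr Ala; rewrite (le_trans (dot_le_norm _ _))//.
  have Hs : `|grad_th h (t + s *: v) a| <= M.
    apply: Hr => //; rewrite -ball_normE /=; apply: lt_le_trans (small _ _ s01 vr) _.
    by rewrite /rho !ge_min lexx.
  rewrite -mulrA ler_pM ?mulr_ge0 ?lerDl// ler_wpM2r//.
have dote s v a : 0 <= s <= 1 -> `|v| < rho -> `|x - a| < d ->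
    `|dot (grad_th h (t + s *: v) a) v - dot (grad_th h t x) v| <= e * `|v|.
  move=> s01 vr xa; rewrite -dotNl -dotDl (le_trans (dot_le_norm _ _))//.
  rewrite [leRHS](_ : _ = (m%:R + 1) * (e' * `|v|)); last first.
    by rewrite /e'; field; rewrite gt_eqF.
  rewrite ler_pM ?mulr_ge0 ?lerDl// ler_wpM2r// ltW// distrC Hd//.
  by apply: lt_le_trans (small _ _ s01 vr) _; rewrite /rho !ge_min lexx orbT.
apply/nbhs_ballP; exists rho => // v; rewrite -ball_normE /= sub0r normrN => vr.
rewrite [v + t]addrC.
have [y ay] := reg_argmax_exists (t + v).
have [s1 s01 E1] := h_mvt_th t v x; have [s2 s02 E2] := h_mvt_th t v y.
have yx : `|x - y| < d.
  have H1 := h_reg_argmax_strong Tht ax ay.1.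
  have H2 := ay.2 x ax.1.
  have := dotM _ _ _ s01 vr ax.1; have := dotM _ _ _ s02 vr ay.1.
  rewrite -E1 -E2 !ler_norml => /andP[H3 H4] /andP[H5 H6].
  have H7 : l / 2 * enorm (y - x) ^+ 2 <= 2 * ((m%:R + 1) * M * `|v|) by lra.
  have : `|v| < l * d ^+ 2 / (4 * (m%:R + 1) * M).
    by apply: lt_le_trans vr _; rewrite /rho ge_min lexx orbT.
  rewrite ltr_pdivlMr ?mulr_gt0// => H8.
  have H9 : l * enorm (y - x) ^+ 2 < l * d ^+ 2 by lra.
  rewrite distrC (le_lt_trans (norm_le_enorm _))//.
  by move: H9; rewrite ltr_pM2l// ltr_pXn2r// ?nnegrE ?enorm_ge0 ?ltW.
rewrite (g_reg_argmax ax) (g_reg_argmax ay).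
have xx : `|x - x| < d by rewrite subrr normr0.
have := dote _ _ _ s01 vr xx; have := dote _ _ _ s02 vr yx.
rewrite -E1 -E2 !ler_norml => /andP[H3 H4] /andP[H5 H6].
have := ay.2 x ax.1; have := ax.2 y ay.1; rewrite -/(F _ _).
by move=> *; apply/andP; split; lra.
Qed.

(** Adding the two strong concavity inequalities bounds [l |x1 - x2|^2] by the increment of
    [h t1 - h t2] between [x2] and [x1], which the mean value theorem in alpha and [lip12]
    estimate. *)
Lemma argmax_lipschitz t1 t2 x1 x2 : Th t1 -> Th t2 ->
  is_argmax Al (F t1) x1 -> is_argmax Al (F t2) x2 ->
  enorm (x1 - x2) <= L12 / l * enorm (t1 - t2).
Proof.
move=> T1 T2 a1 a2; set d := enorm _.
have H1 := h_reg_argmax_strong T1 a1 a2.1; have H2 := h_reg_argmax_strong T2 a2 a1.1.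
have [s [s0 s1]] := @mvt_line _ _ (h t1 \- h t2) x2 x1 (fun s _ _ =>
   differentiableB (diff_al t1 _) (diff_al t2 _)).
set z := _ + _ *: _; have Az : Al z := convex_setP (convex_Al std) a2.1 a1.1 s0 s1.
have -> : grad (h t1 \- h t2) z = grad_al h t1 z - grad_al h t2 z.
  apply/rowP => i; rewrite !mxE.
  by apply: deriveB; apply: diff_derivable; exact: diff_al.
move=> H3; have := cauchy_schwarz (grad_al h t1 z - grad_al h t2 z) (x1 - x2).
rewrite -H3 -/d /= => H4.
have H5 : l * d ^+ 2 <= L12 * enorm (t1 - t2) * d.
  have := ler_wpM2r (enorm_ge0 (x1 - x2)) (lip12 std T1 T2 Az); rewrite -/d => H5.
  by move: H1 H2; rewrite enorm_sub -/d /F /h_reg; lra.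
have [d0|d0] := leP d 0.
  by rewrite (le_trans d0)// mulr_ge0 ?enorm_ge0// divr_ge0 ?ltW// (L12_gt0 std).
by rewrite mulrAC ler_pdivlMr// mulrC -(ler_pM2r d0) -mulrA -expr2.
Qed.

(** The comparison passes through [grad_th h t2 x1]: the move in theta costs [L11], and the move of
    the maximizer costs [L12] times [L12 / l]. *)
Lemma g_reg_grad_lip t1 t2 : Th t1 -> Th t2 ->
  enorm (grad g t1 - grad g t2) <= L_g L11 L12 l * enorm (t1 - t2).
Proof.
move=> T1 T2; have [x1 a1] := reg_argmax_exists t1; have [x2 a2] := reg_argmax_exists t2.
rewrite (g_reg_diff T1 a1).2 (g_reg_diff T2 a2).2.
rewrite -[_ - _](subrKA (grad_th h t2 x1)) (le_trans (enormD _ _))// mulrDl lerD//.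
  by rewrite (lip11 std)//; exact: a1.1.
rewrite (le_trans (lip21 std T2 a1.1 a2.1))//.
rewrite expr2 -!mulrA ler_pM2l ?(L12_gt0 std)// mulrA.
exact: argmax_lipschitz.
Qed.

End envelope.

(** * Rounds of the inner loop and the measure [Y_meas] *)

Section inner_loop.
Context {R : realType} {m n : nat}.
Variables (Th : set 'rV[R]_m) (Al : set 'rV[R]_n).
Variables (h : 'rV[R]_m -> 'rV[R]_n -> R) (p : 'rV[R]_n -> R) (q : 'rV[R]_m -> R).
Variables (rad L11 L22 L12 Lp : R) (E : set 'rV[R]_n) (b : 'rV[R]_n) (l : R).
Hypothesis std : standing Th Al h p q rad L11 L22 L12 Lp.
Hypothesis cdom : concave_domain Th Al h L22 E.
Hypothesis l_gt0 : 0 < l.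

Let F t a := h_reg h b l t a - p a.

(** The condition on [N] turns the accelerated rate into a gap of at most [l / 4 |y 1 - z|^2].
    Strong concavity bounds this by half of the initial gap, and the diameter [2 rad] bounds it by
    [l rad^2]. *)
Lemma inner_round t (N : nat) (x y : nat -> 'rV[R]_n) z :
  Th t -> is_argmax Al (F t) z -> (0 < N)%N ->
  8 * (L22 + l) <= l * (N%:R + 1) ^+ 2 -> Al (y 1%N) ->
  (forall j, (1 <= j <= N)%N -> E (y j)) ->
  (forall j, (1 <= j <= N)%N ->
     prox_al Al (h_reg h b l) p (L22 + l)^-1 t (y j) (x j)) ->
  (forall j, (1 <= j <= N)%N ->
     y j.+1 = x j + ((beta j - 1) / beta j.+1) *: (x j - x j.-1)) ->
  [/\ Al (x N), 2 * (F t z - F t (x N)) <= F t z - F t (y 1%N)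
    & F t z - F t (x N) <= l * rad ^+ 2].
Proof.
move=> Tht az N0 hN Ay1 Ey prox yE.
have cAl := convex_Al std; have AlE := sub_Al_E cdom.
have L0 : 0 < L22 + l by rewrite addr_gt0// (L22_gt0 std).
have AxN : Al (x N) by case: (prox N) => //; rewrite N0 leqnn.
have rate : (N%:R + 1) ^+ 2 * (F t z - F t (x N))
    <= 2 * (L22 + l) * enorm (y 1%N - z) ^+ 2.
  apply: (@fista_rate _ _ Al (F t) (L22 + l) N x y) => //; first 1 last.
  - exact: ltW.
  - by case: az.
  - by move=> j /prox [].
  - move=> j a jN Aa.
    exact: (@prox_gradient_ineq R n Al E (h t) p b l L22 cAl (convex_E cdom)
      AlE (diff_al std t) (concave_h cdom Tht)
      (fun a1 a2 => lip22_E cdom Tht) (convex_p std) l_gt0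
      (x j) (y j) a (Ey j jN) Aa (L22_gt0 std) (prox j jN)).
  - by move=> j /andP[j1 jN]; apply: yE; rewrite j1 ltnW.
  move=> a c s Aa Ac s0 s1; split; first exact: convex_setP.
  exact: (@reg_concave R n Al E (h t) p b l AlE (concave_h cdom Tht)
    (convex_p std) l_gt0).
have near : F t z - F t (x N) <= l / 4 * enorm (y 1%N - z) ^+ 2.
  rewrite -(ler_pM2l (_ : 0 < 8 * (L22 + l)))//; last by rewrite mulr_gt0.
  have : (8 * (L22 + l)) * (F t z - F t (x N)) <=
      l * (N%:R + 1) ^+ 2 * (F t z - F t (x N)).
    by rewrite ler_wpM2r// subr_ge0; case: az => _; apply.
  have := ler_wpM2l (ltW l_gt0) rate; lra.
split => //.
  by have := h_reg_argmax_strong std cdom Tht az Ay1; rewrite -/(F t z) -/(F t (y 1%N)); lra.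
apply: le_trans near _.
have [c Bc] := ball_Al std; have := in_ball_diam Bc Ay1 az.1.
rewrite -(@ler_pXn2r _ 2)// ?nnegrE ?enorm_ge0//; last first.
  by rewrite mulr_ge0// ltW// (rad_gt0 std).
by move=> /(ler_wpM2l (ltW l_gt0)); lra.
Qed.

(** Here [K] is the index of the last round, so [K.+1] rounds are run. The scaled gap [2^(k+1) d_k]
    does not increase with [k], and both bounds hold for it after the first round. *)
Lemma inner_loop_rate t (K N : nat) (a0 : 'rV[R]_n) (x y : nat -> nat -> 'rV[R]_n) z :
  Th t -> is_argmax Al (F t) z -> (0 < N)%N ->
  8 * (L22 + l) <= l * (N%:R + 1) ^+ 2 -> Al a0 -> y 0%N 1%N = a0 ->
  (forall k, (k < K)%N -> y k.+1 1%N = x k N) ->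
  (forall k j, (k <= K)%N -> (1 <= j <= N)%N -> E (y k j)) ->
  (forall k j, (k <= K)%N -> (1 <= j <= N)%N ->
     prox_al Al (h_reg h b l) p (L22 + l)^-1 t (y k j) (x k j)) ->
  (forall k j, (k <= K)%N -> (1 <= j <= N)%N ->
     y k j.+1 = x k j + ((beta j - 1) / beta j.+1) *: (x k j - x k j.-1)) ->
  [/\ Al (x K N), 2 ^+ K.+1 * (F t z - F t (x K N)) <= F t z - F t a0
    & 2 ^+ K.+1 * (F t z - F t (x K N)) <= 2 * (l * rad ^+ 2)].
Proof.
move=> Tht az N0 hN Aa0 y0 yn Ey prox yE.
elim: K yn Ey prox yE => [|K IH] yn Ey prox yE.
  have [|||//|A1 A2 A3] := @inner_round t N (x 0%N) (y 0%N) z Tht az N0 hN.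
  - by rewrite y0.
  - by move=> j; exact: Ey.
  - by move=> j; exact: prox.
  - by move=> j; exact: yE.
  by split=> //; rewrite expr1; [rewrite -y0|lra].
have [||||A1 A2 A3] := IH.
- by move=> k kK; apply: yn; exact: ltnW.
- by move=> k j kK; apply: Ey; exact: ltnW.
- by move=> k j kK; apply: prox; exact: ltnW.
- by move=> k j kK; apply: yE; exact: ltnW.
have [|||//|B1 B2 B3] := @inner_round t N (x K.+1) (y K.+1) z Tht az N0 hN.
- by rewrite yn.
- by move=> j; exact: Ey.
- by move=> j; exact: prox.
- by move=> j; exact: yE.
have : 2 ^+ K.+2 * (F t z - F t (x K.+1 N)) <= 2 ^+ K.+1 * (F t z - F t (x K N)).
  by rewrite [2 ^+ K.+2]exprSr -mulrA ler_pM2l ?exprn_gt0// -(yn K (ltnSn K)).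
by move=> H; split=> //; apply: le_trans H _.
Qed.

Lemma Y_meas_le t al (e : R) : Al b -> Th t -> Al al -> l <= L22 ->
  8 * (l * rad) ^+ 2 <= e ^+ 2 ->
  (forall a, Al a -> 70 * (L22 + l) * (F t a - F t al) <= 3 * e ^+ 2) ->
  Y_meas Al h p L22 t al <= e ^+ 2.
Proof.
move=> Alb Tht Aal lL le de; have L0 := L22_gt0 std; rewrite /Y_meas.
rewrite mulrC -ler_pdivlMr ?mulr_gt0//; apply: maxval_le; first by exists al.
move=> a Aa; rewrite /grad_al; set r := enorm _.
have Ll3 : 3 / 10 * L22 <= L22 + l by have := l_gt0; lra.
(* Testing the gap at [al + s (a - al)] rather than at [a] leaves 7/10 of the
   quadratic term, which absorbs the error [l <al - b, a - al>] caused by the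
   regularization at the price of 5/7 of [e^2]. *)
pose s := 3 / 10 * L22 / (L22 + l).
have Ll0 : 0 < L22 + l by rewrite addr_gt0.
have s0 : 0 < s by rewrite divr_gt0// mulr_gt0.
have s1 : s <= 1 by rewrite ler_pdivrMr// mul1r.
have As := convex_setP (convex_Al std) Aal Aa (ltW s0) s1.
have := @reg_descent_lb R n E (h t) b l L22 (convex_E cdom) (diff_al std t)
  (fun a1 a2 => lip22_E cdom Tht) _ _ (sub_Al_E cdom Aal) (sub_Al_E cdom As).
rewrite [_ + _ - al]addrC addKr grad_reg; last exact: (diff_al std).
rewrite dotZr dotDl dotNl dotZl enormZ exprMn real_normK ?num_real// -/r.
have := convex_functionP (convex_p std) Aal Aa (ltW s0) s1.
have := de _ As; rewrite /F /h_reg.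
have dr : dot (al - b) (a - al) <= 2 * rad * r.
  rewrite (le_trans (cauchy_schwarz _ _))// ler_wpM2r ?enorm_ge0//.
  by have [c Bc] := ball_Al std; exact: in_ball_diam Bc Aal Alb.
move: (dot (grad _ _) _) (al + _ *: _) dr => P z dr.
move: (h t z) (h t al) (enorm (z - b) ^+ 2) (enorm (al - b) ^+ 2).
move: (p z) (p al) (p a) (dot (al - b) _) dr.
move=> pz pal pa D dr hz ha ez ea H1 H2 H3.
have H4 : s * (P - l * D - pa + pal) <=
    3 * e ^+ 2 / (70 * (L22 + l)) + (L22 + l) / 2 * (s ^+ 2 * r ^+ 2).
  have : hz - l / 2 * ez - pz - (ha - l / 2 * ea - pal) <= 3 * e ^+ 2 / (70 * (L22 + l)).
    by rewrite ler_pdivlMr ?mulr_gt0//; lra.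
  by move=> H; lra.
(* Division by [s] turns the tolerance [3 e^2 / (70 (L22 + l))] into [e^2 / (7 L22)], that is 2/7 of
   [e^2] after multiplication by [2 L22]. *)
have H5 : P - l * D - pa + pal <= e ^+ 2 / (7 * L22) + 3 / 20 * L22 * r ^+ 2.
  rewrite -(ler_pM2l s0); apply: le_trans H4 _.
  by rewrite /s le_eqVlt; apply/orP; left; apply/eqP; field; rewrite !gt_eqF.
have H6 : l * D <= l * (2 * rad * r) by rewrite ler_pM2l.
have H7 : P - pa + pal - L22 / 2 * r ^+ 2 <=
    e ^+ 2 / (7 * L22) + 2 * (l * rad) * r - 7 / 20 * L22 * r ^+ 2 by lra.
apply: le_trans H7 _; rewrite ler_pdivlMr ?mulr_gt0//.
have -> : (e ^+ 2 / (7 * L22) + 2 * (l * rad) * r - 7 / 20 * L22 * r ^+ 2) * (2 * L22) =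
   2 / 7 * e ^+ 2 + 4 * (l * rad) * (L22 * r) - 7 / 10 * (L22 * r) ^+ 2.
  by field; rewrite gt_eqF.
move: le; move: (l * rad) (L22 * r) => u v.
(* The maximum of [4 u v - 7/10 v^2] over [v] is [40/7 u^2], which is 5/7 of [8 u^2]. *)
by have := sqr_ge0 (u * 2 - v * (7 / 10)); lra.
Qed.

End inner_loop.

(** * The outer proximal gradient step *)

Section outer_loop.
Context {R : realType} {m n : nat}.
Variables (Th : set 'rV[R]_m) (Al : set 'rV[R]_n).
Variables (h : 'rV[R]_m -> 'rV[R]_n -> R) (p : 'rV[R]_n -> R) (q : 'rV[R]_m -> R).
Variables (rad L11 L22 L12 Lp : R) (E : set 'rV[R]_n) (b : 'rV[R]_n) (l : R).
Hypothesis std : standing Th Al h p q rad L11 L22 L12 Lp.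
Hypothesis cdom : concave_domain Th Al h L22 E.
Hypothesis Alb : Al b.
Hypothesis l_gt0 : 0 < l.

Let F t a := h_reg h b l t a - p a.
Let g := g_reg Al h p b l.
Let Lg := L_g L11 L12 l.

Lemma L_g_gt0 : 0 < Lg.
Proof.
by rewrite ltr_wpDl ?(L11_ge0 std)// divr_gt0// exprn_gt0// (L12_gt0 std).
Qed.

Lemma grad_th_reg t a : grad_th (h_reg h b l) t a = grad_th h t a.
Proof.
apply/rowP => i; rewrite !mxE.
have Df := diff_derivable (v := delta_mx 0 i) (diff_th std t a).
rewrite (_ : (fun x => h_reg h b l x a) =
  ((h ^~ a : 'rV[R]_m -> R^o) - cst (l / 2 * enorm (a - b) ^+ 2)))//.
by rewrite deriveB// derive_cst subr0.
Qed.

(** Testing the inner maximum at [b], where the regularizer vanishes, gives a bound uniform in the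
    regularization parameter; the complexity estimate relies on this uniformity. *)
Lemma objective_lower_bound : exists c, forall l' t, Th t -> c <= g_reg Al h p b l' t + q t.
Proof.
have [T0|T0] := pselect (Th !=set0); last first.
  by exists 0 => l' t Tt; exfalso; apply: T0; exists t.
have [t1 [T1 H]] : exists x, is_argmax Th (fun t => - q t - h t b) x.
  apply: argmax_exists => //; first exact: compact_Th std.
  apply: withinB; last by apply: differentiable_within => x _; exact: (diff_th std).
  by move=> x; apply: cvgN; exact: (cont_q std).
exists (q t1 + h t1 b - p b) => l' t Tt.
have := @g_reg_ge R m n Th Al h p q rad L11 L22 L12 Lp b l' std Alb t b Alb; have := H t Tt.
rewrite /h_reg subrr enorm0 expr0n/= mulr0 subr0; lra.
Qed.

Lemma gap_D_ge t0 t : Th t -> g t0 + q t0 - gap_D Th Al h p q b l t0 <= g t + q t.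
Proof.
move=> Tt; have [c H] := objective_lower_bound; rewrite opprB addrC subrK.
by apply: (@minval_le _ _ Th (fun t => g t + q t) c t) => // x; exact: H.
Qed.

Lemma g_reg_descent t s : Th t -> Th s ->
  g s <= g t + dot (grad g t) (s - t) + Lg / 2 * enorm (s - t) ^+ 2.
Proof.
move=> Tt Ts; suff : `|g s - g t - dot (grad g t) (s - t)| <= Lg / 2 * enorm (s - t) ^+ 2.
  by rewrite ler_norml => /andP[_]; lra.
have Tl r : 0 <= r -> r <= 1 -> Th (t + r *: (s - t)) := convex_setP (convex_Th std) Tt Ts.
apply: descent => r r0 r1.
  have [x ax] := reg_argmax_exists l std Alb (t + r *: (s - t)).
  exact: (g_reg_diff std cdom Alb l_gt0 (Tl r r0 r1) ax).1.
rewrite (le_trans (g_reg_grad_lip std cdom Alb l_gt0 (Tl r r0 r1) Tt))//.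
by rewrite addrAC subrr add0r enormZ ger0_norm.
Qed.

Section step.
Variables (t s : 'rV[R]_m) (a z : 'rV[R]_n).
Hypothesis (Tt : Th t) (az : is_argmax Al (F t) z) (Aa : Al a).
Hypothesis prox : prox_th Th (h_reg h b l) q Lg^-1 t a s.

(** The objective of the outer proximal step, shifted to vanish at [t]; [- model s] measures
    stationarity. *)
Let model x := dot (grad_th h t a) (x - t) + Lg / 2 * enorm (x - t) ^+ 2 + q x - q t.

Let model_argmin : is_argmin Th model s.
Proof.
case: prox => Ts H; split=> // x Tx.
by have := H x Tx; rewrite grad_th_reg invfM invrK [2^-1 * _]mulrC /model; lra.
Qed.

Let model_convex x (r : R) : Th x -> 0 <= r -> r <= 1 -> model (s + r *: (x - s)) <=
  model s + r * (model x - model s) - Lg / 2 * (r * (1 - r)) * enorm (x - s) ^+ 2.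
Proof.
move=> Tx r0 r1; rewrite /model enorm_sqr_line.
have -> : s + r *: (x - s) - t = (s - t) + r *: ((x - t) - (s - t)).
  by rewrite addrAC opprB addrA subrK.
have := convex_functionP (convex_q std) model_argmin.1 Tx r0 r1; rewrite !dotE; lra.
Qed.

Let model_t : model t = 0.
Proof. by rewrite /model subrr enorm0 dotC dot0l; lra. Qed.

(** The model is strongly convex with modulus [Lg], minimal at [s] and zero at [t]. *)
Lemma prox_step_length : Lg / 2 * enorm (s - t) ^+ 2 <= - model s.
Proof.
have := argmin_strong (convex_Th std) model_argmin Tt (fun r => @model_convex t r Tt).
by rewrite model_t enorm_sub; lra.
Qed.

(** The step uses the gradient at [a] where the gradient of [g] is the one at the maximizer [z]; the
    last summand is the price of this inexactness. *)
Lemma outer_descent : g s + q s <=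
  g t + q t + model s + L12 * enorm (a - z) * enorm (s - t).
Proof.
have := g_reg_descent Tt model_argmin.1; rewrite (g_reg_diff std cdom Alb l_gt0 Tt az).2.
have := cauchy_schwarz (grad_th h t z - grad_th h t a) (s - t).
have := ler_wpM2r (enorm_ge0 (s - t)) (lip21 std Tt az.1 Aa).
rewrite (enorm_sub z) dotDl dotNl /model; lra.
Qed.

Lemma X_meas_le (e : R) : - model s <= e ^+ 2 / (2 * Lg) ->
  X_meas Th h q L11 t a <= e ^+ 2.
Proof.
move=> H; rewrite /X_meas; have Lg0 := L_g_gt0.
have := L11_ge0 std; rewrite le_eqVlt => /predU1P[<-|L0].
  by rewrite mulr0 oppr0 mul0r sqr_ge0.
rewrite mulNr lerNl -ler_pdivrMl ?mulr_gt0//.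
apply: minval_ge; first by exists t.
(* [X_meas] uses L11 whereas the step uses Lg >= L11: by convexity of [q], the
   model with Lg at [t + r (x - t)] is at most [r] times the one with L11 at [x]. *)
move=> x Tx; pose r := L11 / Lg.
have r0 : 0 < r by rewrite divr_gt0.
have r1 : r <= 1.
  by rewrite ler_pdivrMr// mul1r lerDl divr_ge0 ?sqr_ge0// ltW.
have Tr := convex_setP (convex_Th std) Tt Tx (ltW r0) r1.
have := model_argmin.2 _ Tr; rewrite /model.
have -> : t + r *: (x - t) - t = r *: (x - t) by rewrite addrAC subrr add0r.
rewrite enormZ exprMn.
rewrite real_normK ?num_real// dotZr.
have := convex_functionP (convex_q std) Tt Tx (ltW r0) r1.
move: (q (t + _)) (dot _ (x - t)) (enorm (x - t)) => qr d w H1 H2.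
have H3 : - (e ^+ 2 / (2 * Lg)) <= r * (d + q x - q t + L11 / 2 * w ^+ 2).
  rewrite lerNl; apply: le_trans H; rewrite lerN2 /model.
  have : Lg / 2 * (r ^+ 2 * w ^+ 2) = r * (L11 / 2 * w ^+ 2).
    by rewrite /r; field; rewrite gt_eqF.
  by move=> H3; lra.
rewrite -(ler_pM2l r0); apply: le_trans H3.
by rewrite /r le_eqVlt; apply/orP; left; apply/eqP; field; rewrite !gt_eqF.
Qed.

End step.
End outer_loop.

(** * Numerical constants *)

Section constants.
Context {R : realType}.
Implicit Types (l rad eps d w A D : R).

(** From [1 - 1/32 <= exp (-1/32)] one gets [exp (1/32) <= 32/31], which is squared five times with
    rounding up. The value 14/5 is 7/10 of 4. *)
Lemma expR1_le : expR 1 <= 14 / 5 :> R.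
Proof.
have x1 : expR (32^-1) <= 32 / 31 :> R.
  have H : 1 - 32^-1 <= (expR (32^-1))^-1 :> R by rewrite -expRN; exact: expR_ge1Dx.
  rewrite -[leLHS]invrK -[leRHS]invrK lef_pV2 ?posrE ?invr_gt0 ?expR_gt0//; last by lra.
have sq (x c c' : R) : 0 <= x -> x <= c -> c ^+ 2 <= c' -> x ^+ 2 <= c'.
  by move=> x0 xc; apply: le_trans; rewrite ler_pXn2r ?nnegrE// (le_trans x0).
have x0 k : 0 <= expR (32^-1) ^+ k :> R by rewrite exprn_ge0// expR_ge0.
have x2 : expR (32^-1) ^+ 2 <= 1066 / 1000 :> R.
  by apply: (sq _ _ _ _ x1); [exact: (x0 1%N)|lra].
have x4 : expR (32^-1) ^+ 4 <= 1137 / 1000 :> R.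
  by rewrite (exprM _ 2 2); apply: (sq _ _ _ _ x2); [exact: x0|lra].
have x8 : expR (32^-1) ^+ 8 <= 1293 / 1000 :> R.
  by rewrite (exprM _ 4 2); apply: (sq _ _ _ _ x4); [exact: x0|lra].
have x16 : expR (32^-1) ^+ 16 <= 1672 / 1000 :> R.
  by rewrite (exprM _ 8 2); apply: (sq _ _ _ _ x8); [exact: x0|lra].
have -> : 1 = 32%:R * 32^-1 :> R by rewrite divff.
by rewrite expRM_natl (exprM _ 16 2); apply: (sq _ _ _ _ x16); [exact: x0|lra].
Qed.

Lemma lambda_gt0 (L22 : R) rad eps : 0 < L22 -> 0 < rad -> 0 < eps -> 0 < lambda L22 rad eps.
Proof. by move=> L0 r0 e0; rewrite lt_min L0 divr_gt0// !mulr_gt0// sqrtr_gt0. Qed.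

Lemma lambda_le (L22 : R) rad eps : lambda L22 rad eps <= L22.
Proof. by rewrite ge_min lexx. Qed.

Lemma lambda_sqr_le (L22 : R) rad eps : 0 < L22 -> 0 < rad -> 0 < eps ->
  8 * (lambda L22 rad eps * rad) ^+ 2 <= eps ^+ 2.
Proof.
move=> L0 r0 e0; have l0 := lambda_gt0 L0 r0 e0; have s0 : 0 < Num.sqrt 2 :> R by rewrite sqrtr_gt0.
have : lambda L22 rad eps <= eps / (2 * Num.sqrt 2 * rad) by rewrite ge_min lexx orbT.
rewrite ler_pdivlMr ?mulr_gt0// => H.
have -> : 8 * (lambda L22 rad eps * rad) ^+ 2 =
    (lambda L22 rad eps * (2 * Num.sqrt 2 * rad)) ^+ 2.
  have := @sqr_sqrtr R 2 (ler0n _ _); move: (Num.sqrt 2) (lambda _ _ _) => s l sE.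
  by rewrite !exprMn sE; ring.
by rewrite ler_pXn2r// nnegrE ?mulr_ge0// ltW.
Qed.

(** With [s = sqrt (8 kappa)], the ceiling of [s - 1] lies in [[s - 1, s[], and [l <= L22] ensures
    [s > 1], so the ceiling is positive and [absz] leaves it unchanged. *)
Lemma N_inner_spec l (L22 : R) : 0 < l -> l <= L22 ->
  [/\ (0 < N_inner L22 l)%N, 8 * (L22 + l) <= l * ((N_inner L22 l)%:R + 1) ^+ 2
    & (N_inner L22 l)%:R < Num.sqrt (8 * kappa L22 l)].
Proof.
move=> l0 lL; rewrite /N_inner /kappa mulrA.
set s := Num.sqrt _; set c := Num.ceil _.
have k0 : 0 <= 8 * (L22 + l) / l.
  by rewrite divr_ge0 ?(ltW l0)// mulr_ge0// addr_ge0// ltW// (lt_le_trans l0).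
have sE : s ^+ 2 = 8 * (L22 + l) / l by rewrite sqr_sqrtr.
have s1 : 1 < s.
  rewrite -sqrtr1 ltr_sqrt; last by rewrite divr_gt0// mulr_gt0// addr_gt0// (lt_le_trans l0).
  by rewrite ltr_pdivlMr//; lra.
have c0 : 0 < c by rewrite ceil_gt0 subr_gt0.
have cE : (`|c|%N)%:R = c%:~R :> R by rewrite -[in RHS](gtz0_abs c0).
have cs : s - 1 <= c%:~R by exact: ceil_ge.
have cs' : c%:~R - 1 < s - 1.
  by have := ceilB1_lt (s - 1); rewrite -/c rmorphB.
split; first by rewrite absz_gt0 gt_eqF.
  have -> : 8 * (L22 + l) = l * s ^+ 2 by rewrite sE; field; rewrite gt_eqF.
  rewrite ler_pM2l// cE ler_pXn2r ?nnegrE//; lra.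
by rewrite cE; lra.
Qed.

(** [M] stands for the bracket in [N_K]. Its logarithms may make it negative, and then nothing is to
    prove; otherwise [K < (K / N + 1) N] and [N < s] give the claim. *)
Lemma rounds_lower_bound (s M : R) (K N : nat) : (0 < N)%N -> N%:R < s ->
  2 * s * M <= K%:R -> 2 * M <= (K %/ N).+1%:R.
Proof.
move=> N0 Ns H; have [M0|M0] := leP M 0; first by apply: (@le_trans _ _ 0); rewrite ?ler0n//; lra.
have N0' : 0 < N%:R :> R by rewrite ltr0n.
have := ltn_ceil K N0; rewrite -(ltr_nat R) natrM => H1.
rewrite -(ler_pM2r N0') ltW//; apply: le_lt_trans H1; apply: le_trans H.
by rewrite [2 * s * M]mulrAC ler_pM2l ?mulr_gt0// ltW.
Qed.

(** Exponentiation turns the hypothesis into [A^2 (2 / eps)^4 (2 D / l) <= e^r], and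
    [32 = 2^4 * 2]. *)
Lemma exp_rounds A eps D l (r : nat) : 0 < A -> 0 < eps -> 0 < D -> 0 < l ->
  2 * (ln A + 2 * ln (2 / eps) + 2^-1 * ln (2 * D / l)) <= r%:R ->
  32 * A ^+ 2 * D <= l * eps ^+ 4 * expR 1 ^+ r.
Proof.
move=> A0 e0 D0 l0 H.
have e2 : 0 < 2 / eps by rewrite divr_gt0.
have D2 : 0 < 2 * D / l by rewrite divr_gt0// mulr_gt0.
have : A ^+ 2 * (2 / eps) ^+ 4 * (2 * D / l) <= expR 1 ^+ r.
  move: (2 / eps) (2 * D / l) e2 D2 H => u v u0 v0 H.
  rewrite -expRM_natl mulr1 -[leLHS]lnK ?posrE ?mulr_gt0 ?exprn_gt0// ler_expR.
  rewrite lnM ?posrE ?mulr_gt0 ?exprn_gt0// lnM ?posrE ?exprn_gt0// (lnXn 2 A0) (lnXn 4 u0).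
  rewrite -[ln A *+ 2]mulr_natl -[ln u *+ 4]mulr_natl; lra.
rewrite -(ler_pM2l (_ : 0 < l * eps ^+ 4)) ?mulr_gt0 ?exprn_gt0//.
apply: le_trans; rewrite le_eqVlt; apply/orP; left; apply/eqP; field.
by rewrite !gt_eqF.
Qed.

Lemma gap_after_rounds A eps D l rad d (r : nat) : 0 < A -> 0 < eps -> 0 < l ->
  0 < rad -> 0 <= d -> 2 ^+ r.+1 * d <= D -> 2 ^+ r.+1 * d <= 2 * (l * rad ^+ 2) ->
  32 * A ^+ 2 * D <= l * eps ^+ 4 * expR 1 ^+ r.+1 ->
  100 * (A * d) <= 21 * (l * rad * eps ^+ 2).
Proof.
move=> A0 e0 l0 r0 d0 dD dl H.
(* One factor uses [e <= 14/5], the remaining ones [e <= 4]. The final constant 21/100 rounds up the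
   square root of [7/160]. *)
have e4 : expR 1 ^+ r.+1 <= 7 / 10 * (2 ^+ r.+1) ^+ 2 :> R.
  have e4' : expR 1 <= 4 :> R by apply: le_trans expR1_le _; lra.
  rewrite -exprM mulnC exprM -natrX exprS [(2 ^ 2)%:R ^+ _]exprS mulrA.
  rewrite ler_pM ?exprn_ge0 ?expR_ge0//.
    by apply: le_trans expR1_le _; rewrite /=; lra.
  by rewrite lerXn2r ?nnegrE ?expR_ge0 ?ler0n //=.
have P0 : 0 < 2 ^+ r.+1 :> R by rewrite exprn_gt0.
move: (2 ^+ r.+1) (expR 1 ^+ r.+1) P0 dD dl H e4 => P e P0 dD dl H e4.
have lr0 : 0 < l * rad ^+ 2 by rewrite mulr_gt0// exprn_gt0.
have H1 : (P * d) * (P * d) <= D * (2 * (l * rad ^+ 2)).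
  by rewrite ler_pM// mulr_ge0// ltW.
have H2 : 16 * A ^+ 2 * ((P * d) * (P * d)) <= (l * rad ^+ 2) * (l * eps ^+ 4 * e).
  apply: (@le_trans _ _ (16 * A ^+ 2 * (D * (2 * (l * rad ^+ 2))))).
    by rewrite ler_pM2l// mulr_gt0// exprn_gt0.
  by have := ler_wpM2l (ltW lr0) H; lra.
have H3 : P ^+ 2 * (16 * (A * d) ^+ 2) <= P ^+ 2 * (7 / 10 * (l * rad * eps ^+ 2) ^+ 2).
  have c0 : 0 <= (l * rad ^+ 2) * (l * eps ^+ 4) by rewrite !mulr_ge0 ?exprn_ge0// ltW.
  by have := ler_wpM2l c0 e4; lra.
rewrite ler_pM2l ?exprn_gt0// in H3.
have X0 : 0 <= l * rad * eps ^+ 2 by rewrite !mulr_ge0 ?sqr_ge0// ltW.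
have Y0 : 0 <= A * d by rewrite mulr_ge0// ltW.
rewrite -(@ler_pXn2r _ 2)// ?nnegrE; [|by rewrite mulr_ge0|by rewrite mulr_ge0].
by have := sqr_ge0 (l * rad * eps ^+ 2); lra.
Qed.

(** As [2 l <= L], the lower bound on [A] is at least [5 l L rad], and [l rad] cancels; [L] stands
    for [L22 + l]. *)
Lemma gap_condition (L : R) l A d eps rad : 0 < l -> 0 < rad -> 2 * l <= L -> 0 <= d ->
  L * ((2 * L + l) * rad) <= A -> 100 * (A * d) <= 21 * (l * rad * eps ^+ 2) ->
  70 * L * d <= 3 * eps ^+ 2.
Proof.
move=> l0 r0 lL d0 AL H.
have L0 : 0 < L by lra.
have H1 : L * ((5 * l) * rad) * d <= A * d.
  rewrite ler_wpM2r//; apply: le_trans AL; rewrite ler_pM2l// ler_pM2r//; lra.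
have : (l * rad) * (500 * L * d) <= (l * rad) * (21 * eps ^+ 2) by lra.
rewrite ler_pM2l ?mulr_gt0//; have := sqr_ge0 eps; lra.
Qed.

(* Interpolates between w^2 <= 2 rad^2 and the bound given by the last hypothesis,
   each of which fails to suffice for some values of eps / (L12 rad). *)
Lemma distance_condition (Lg L12 : R) l d rad eps w : 0 < Lg -> 0 < L12 -> 0 < l -> 0 < rad ->
  0 < eps -> 0 <= d -> L12 ^+ 2 <= l * Lg -> 8 * (l * rad) ^+ 2 <= eps ^+ 2 ->
  l / 2 * w ^+ 2 <= d -> d <= l * rad ^+ 2 -> 0 <= w ->
  100 * (4 * (Lg * L12 * rad) * d) <= 21 * (l * rad * eps ^+ 2) ->
  8 * (L12 * w) <= 3 * eps.
Proof.
move=> Lg0 k0 l0 r0 e0 d0 kl le wd dl w0 H.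
have w2 : w ^+ 2 <= 2 * rad ^+ 2 by rewrite -(ler_pM2l l0); lra.
have H1 : 200 * (Lg * L12 * w ^+ 2) <= 21 * eps ^+ 2.
  have H0 : (rad * (Lg * L12)) * (l / 2 * w ^+ 2) <= (rad * (Lg * L12)) * d.
    by rewrite ler_pM2l// !mulr_gt0.
  rewrite -(ler_pM2l (mulr_gt0 l0 r0)); lra.
have H2 : L12 ^+ 3 * w ^+ 2 <= 21 / 200 * (l * eps ^+ 2).
  have := ler_wpM2l (ltW l0) H1; have c0 : 0 <= L12 * w ^+ 2 by rewrite mulr_ge0 ?sqr_ge0// ltW.
  have := ler_wpM2r c0 kl; lra.
have u0 : 0 <= L12 ^+ 3 * w ^+ 2 by rewrite mulr_ge0 ?exprn_ge0// ltW.
(* The factor [l^2] from squaring [H2] meets the [rad^2] of [w2], and [(l rad)^2 <= eps^2 / 8] then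
   gives a bound on the sixth power of [L12 w]. *)
have H3 : (L12 ^+ 3 * w ^+ 2) ^+ 2 * w ^+ 2 <= (21 / 200 * (l * eps ^+ 2)) ^+ 2 * (2 * rad ^+ 2).
  apply: ler_pM; rewrite ?sqr_ge0 ?ler_pXn2r// nnegrE ?u0//; exact: le_trans H2.
have H4 : (21 / 200) ^+ 2 / 4 <= (3 / 8) ^+ 6 :> R by lra.
have H5 := ler_wpM2r (exprn_ge0 4 (ltW e0)) le.
have H6 : (L12 * w) ^+ 6 <= (3 / 8 * eps) ^+ 6.
  have -> : (L12 * w) ^+ 6 = (L12 ^+ 3 * w ^+ 2) ^+ 2 * w ^+ 2 by ring.
  apply: (le_trans H3).
  rewrite [leLHS](_ : _ = (21 / 200) ^+ 2 / 4 * (8 * (l * rad) ^+ 2 * eps ^+ 4));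
    last by field.
  rewrite (exprMn 6); apply: ler_pM H4 _; first by lra.
    by rewrite !mulr_ge0 ?sqr_ge0 ?exprn_ge0// ltW.
  by apply: le_trans H5 _; rewrite -exprD.
have w0' : 0 <= L12 * w by rewrite mulr_ge0// ltW.
have e0' : 0 <= 3 / 8 * eps by rewrite mulr_ge0// ltW.
by move: H6; rewrite ler_pXn2r// ?nnegrE//; lra.
Qed.

End constants.

(** * Convergence *)

Section convergence.
Context {R : realType} {m n : nat}.
Variables (Th : set 'rV[R]_m) (Al : set 'rV[R]_n).
Variables (h : 'rV[R]_m -> 'rV[R]_n -> R) (p : 'rV[R]_n -> R) (q : 'rV[R]_m -> R).
Variables (rad L11 L22 L12 Lp : R) (E : set 'rV[R]_n) (ahat : 'rV[R]_n).
Hypothesis std : standing Th Al h p q rad L11 L22 L12 Lp.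
Hypothesis cdom : concave_domain Th Al h L22 E.
Hypothesis Alb : Al ahat.

(** If the set of values has no supremum, [sup] takes its default value 0. *)
Lemma maxval_grad_ge0 t : 0 <= maxval Al (fun a => enorm (grad_al h t a)).
Proof.
rewrite /maxval; have [hs|hs] := pselect (has_sup ((fun a => enorm (grad_al h t a)) @` Al)).
  apply: le_trans (ub_le_sup hs.2 _); last by exists ahat.
  exact: enorm_ge0.
by rewrite sup_out.
Qed.

Variables (eps : R) (K T : nat) (Delta : nat -> R).
Variables (th : nat -> 'rV[R]_m) (al : nat -> 'rV[R]_n).
Variables (x y : nat -> nat -> nat -> 'rV[R]_n).
Let l := lambda L22 rad eps.
Let N := N_inner L22 l.
Let Lg := L_g L11 L12 l.
Hypothesis eps_gt0 : 0 < eps.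
Hypothesis runs : run Th Al (h_reg h ahat l) p q K T N (L22 + l)^-1 Lg^-1 th al x y.
Hypothesis y_in : forall t k j, (t < T)%N -> (k <= K %/ N)%N -> (1 <= j <= N)%N -> E (y t k j).
Hypothesis Delta_gap : forall t, (t < T)%N ->
  g_reg Al h p ahat l (th t) - (h_reg h ahat l (th t) (al t) - p (al t)) < Delta t.
Hypothesis K_large : forall t, (t < T)%N ->
  N_K Al h rad L11 L22 L12 Lp (th t) (Delta t) eps <= K%:R.

Let F t a := h_reg h ahat l t a - p a.
Let l_gt0 : 0 < l := lambda_gt0 (L22_gt0 std) (rad_gt0 std) eps_gt0.
Let l_le : l <= L22 := lambda_le _ _ _.

Lemma run_Th t : (t <= T)%N -> Th (th t).
Proof. by case: t => [_|t tT]; [exact: (run_th0 runs)|case: (run_th runs tT)]. Qed.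

Lemma run_Al t : (t <= T)%N -> Al (al t).
Proof.
case: t => [_|t tT]; first exact: (run_al0 runs).
have [N0 _ _] := N_inner_spec l_gt0 l_le.
rewrite (run_al runs tT).
by have [] := run_x runs tT (leqnn _) (_ : (1 <= N <= N)%N); rewrite ?N0 ?leqnn.
Qed.

Lemma inner_accuracy t z : (t < T)%N -> is_argmax Al (F (th t)) z ->
  70 * (L22 + l) * (F (th t) z - F (th t) (al t.+1)) <= 3 * eps ^+ 2 /\
  8 * (L12 * enorm (al t.+1 - z)) <= 3 * eps.
Proof.
move=> tT az; have [N0 hN Ns] := N_inner_spec l_gt0 l_le.
have Tt := run_Th (ltnW tT); have Aat := run_Al (ltnW tT).
have [|||||_] := @inner_loop_rate R m n Th Al h p q rad L11 L22 L12 Lp E ahat l std cdom l_gt0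
  (th t) (K %/ N) N (al t) (x t) (y t) z Tt az N0 hN Aat.
- by rewrite (run_y1_first runs tT) (run_x0 runs tT).
- by move=> k kK; exact: (run_y1_next runs).
- by move=> k j kK; exact: y_in.
- by move=> k j kK; exact: (run_x runs).
- by move=> k j kK; exact: (run_y runs).
rewrite -(run_al runs tT); set d := F (th t) z - _; set r := (K %/ N)%N => dD dR.
have L0 := L22_gt0 std; have L12_0 := L12_gt0 std; have r0 := rad_gt0 std.
have Ll0 : 0 < L22 + l by rewrite addr_gt0.
have Lg0 : 0 < Lg := L_g_gt0 std l_gt0.
have d0 : 0 <= d by rewrite subr_ge0; apply: az.2; exact: run_Al.
have gE : g_reg Al h p ahat l (th t) = F (th t) z := g_reg_argmax az.
have D0 : F (th t) z - F (th t) (al t) < Delta t by rewrite -gE; exact: Delta_gap.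
have Dp : 0 < Delta t by apply: le_lt_trans D0; rewrite subr_ge0; apply: az.2.
have {}dD : 2 ^+ r.+1 * d <= Delta t by apply: le_trans dD (ltW D0).
(* This supplies the summand [l * rad] in the lower bound on [A] required by [gap_condition]. *)
have Gm : l * rad <= g_max Al h rad l (th t) by rewrite lerDr maxval_grad_ge0.
have := rounds_lower_bound N0 Ns (K_large tT); rewrite -/l -/r.
(* [A1] and [A2] are the exponentials of the two entries of the maximum in [C_const]: [A1] serves
   the distance to the maximizer, [A2] the inner gap. *)
pose A1 := 4 * (Lg * L12 * rad).
pose A2 := (L22 + l) * (2 * (L22 + l) * rad + g_max Al h rad l (th t) + Lp + rad).
have Lp0 := Lp_ge0 std.
have P2 : (2 * (L22 + l) + l) * rad <= 2 * (L22 + l) * rad + g_max Al h rad l (th t) + Lp + rad.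
  by lra.
have P2' : 0 < 2 * (L22 + l) * rad + g_max Al h rad l (th t) + Lp + rad.
  by apply: lt_le_trans P2; rewrite mulr_gt0// addr_gt0// mulr_gt0.
have A10 : 0 < A1 by rewrite !mulr_gt0.
have A20 : 0 < A2 by rewrite mulr_gt0.
have lnA1 : ln A1 = 2 * ln 2 + ln (Lg * L12 * rad).
  rewrite /A1 lnM ?posrE ?mulr_gt0//; congr (_ + _).
  by rewrite (_ : 4 = 2 ^+ 2) ?lnXn// ?mulr_natl//; lra.
have lnA2 : ln A2 = ln (L22 + l) + ln (2 * (L22 + l) * rad + g_max Al h rad l (th t) + Lp + rad).
  by rewrite lnM.
rewrite /C_const -lnA1 -lnA2 => H.
have [H1 H2] : 2 * (ln A1 + 2 * ln (2 / eps) + 2^-1 * ln (2 * Delta t / l)) <= r.+1%:R /\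
     2 * (ln A2 + 2 * ln (2 / eps) + 2^-1 * ln (2 * Delta t / l)) <= r.+1%:R.
  have M1 : ln A1 <= Num.max (ln A1) (ln A2) by rewrite le_max lexx.
  have M2 : ln A2 <= Num.max (ln A1) (ln A2) by rewrite le_max lexx orbT.
  by move: (Num.max _ _) H M1 M2 => M H M1 M2; split; lra.
have := gap_after_rounds A10 eps_gt0 l_gt0 r0 d0 dD dR (exp_rounds A10 eps_gt0 Dp l_gt0 H1).
have := gap_after_rounds A20 eps_gt0 l_gt0 r0 d0 dD dR (exp_rounds A20 eps_gt0 Dp l_gt0 H2).
move=> B2 B1; split.
  apply: gap_condition B2 => //; last by rewrite /A2 ler_pM2l.
  by have := l_le; lra.
have dlR : d <= l * rad ^+ 2.
  have : 2 * d <= 2 ^+ r.+1 * d by rewrite exprS -mulrA ler_pM2l// ler_peMl// exprn_ege1// ler1n.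
  by lra.
apply: (@distance_condition _ Lg L12 l d rad eps) => //.
- rewrite /Lg /L_g mulrDr [l * (_ / _)]mulrC divfK ?gt_eqF// lerDr.
  by rewrite mulr_ge0 ?(L11_ge0 std)// ltW.
- exact: lambda_sqr_le.
- exact: (h_reg_argmax_strong std cdom Tt az (run_Al tT)).
- exact: enorm_ge0.
Qed.

(** The inner accuracy makes [Y_meas] small at every iteration. If [X_meas] were not controlled at
    any of them, each step would lower [G] by more than [eps^2 / (8 Lg)], and [T] steps would lead
    below its minimum. *)
Lemma convergence : (0 < T)%N ->
  N_T Th Al h p q rad L11 L22 L12 ahat (th 0%N) eps <= T%:R ->
  exists2 t, (t < T)%N & eps_FNE Th Al h p q L11 L22 eps (th t) (al t.+1).
Proof.
move=> T0 T_large; have Lg0 : 0 < Lg := L_g_gt0 std l_gt0.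
pose G t := g_reg Al h p ahat l (th t) + q (th t).
pose model t := dot (grad_th h (th t) (al t.+1)) (th t.+1 - th t)
  + Lg / 2 * enorm (th t.+1 - th t) ^+ 2 + q (th t.+1) - q (th t).
have [[t tT small]|none] := pselect (exists2 t, (t < T)%N & - model t <= eps ^+ 2 / (2 * Lg)).
  exists t => //; have Tt := run_Th (ltnW tT); have Aat := run_Al tT.
  have [z az] := reg_argmax_exists l std Alb (th t).
  split => //.
    exact: (X_meas_le std l_gt0 Tt (run_th runs tT)).
  apply: (Y_meas_le std cdom l_gt0 Alb) => //.
    exact: lambda_sqr_le (L22_gt0 std) (rad_gt0 std) eps_gt0.
  move=> a Aa; apply: le_trans (inner_accuracy tT az).1.
  have L0 := L22_gt0 std.
  apply: ler_wpM2l; first by rewrite mulr_ge0// addr_ge0// ltW.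
  by apply: lerB => //; exact: az.2.
have step t : (t < T)%N -> G t.+1 < G t - eps ^+ 2 / (8 * Lg).
  move=> tT; have Tt := run_Th (ltnW tT); have Aat := run_Al tT.
  have [z az] := reg_argmax_exists l std Alb (th t).
  have := outer_descent std cdom Alb l_gt0 Tt az Aat (run_th runs tT).
  have := prox_step_length std Tt (run_th runs tT).
  have [_ acc] := inner_accuracy tT az.
  rewrite -!addrA; rewrite -/(G t.+1).
  have big : eps ^+ 2 / (2 * Lg) < - model t.
    by rewrite ltNge; apply/negP => H; apply: none; exists t.
  move: big; rewrite /G /model -/Lg.
  move: (dot _ _) (enorm (th t.+1 - th t)) (enorm_ge0 (th t.+1 - th t)) acc => d w w0 acc.
  move: (L12 * enorm _) acc => e acc.
  move: (q _) (q _) (g_reg _ _ _ _ _ _) (g_reg _ _ _ _ _ _) => q1 q0 g1 g0.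
  (* [X] is [- model t]. From [eps^2 <= 2 Lg X] and [Lg w^2 <= 2 X] follows [eps w <= 2 X], so the
     inexactness, at most [3/8 eps w], consumes 3/4 of [X]; the remaining quarter exceeds
     [eps^2 / (8 Lg)]. *)
  set X := - (d + _ + _ - _) => big H1 H2.
  have e2 : eps ^+ 2 <= 2 * Lg * X by move: big; rewrite ltr_pdivrMr ?mulr_gt0//; lra.
  have H1' : Lg * w ^+ 2 <= 2 * X by rewrite /X; lra.
  have X0 : 0 < X by apply: le_lt_trans big; rewrite divr_ge0 ?sqr_ge0// mulr_ge0// ltW.
  have ew : eps * w <= 2 * X.
    rewrite -(@ler_pXn2r _ 2)// ?nnegrE ?mulr_ge0 ?(ltW eps_gt0) ?(ltW X0)//.
    rewrite exprMn; have : eps ^+ 2 * w ^+ 2 <= 2 * Lg * X * w ^+ 2 by rewrite ler_wpM2r ?sqr_ge0.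
    by have := ler_wpM2r (ltW X0) H1'; lra.
  have ew' : 4 * (e * w) <= 3 * X.
    by have := ler_wpM2r w0 acc; lra.
  have : eps ^+ 2 / (8 * Lg) < X / 4.
    have -> : eps ^+ 2 / (8 * Lg) = eps ^+ 2 / (2 * Lg) / 4 by field; rewrite gt_eqF.
    by rewrite ltr_pM2r.
  by rewrite /X in ew' *; lra.
have acc t : (t <= T)%N -> G t <= G 0%N - t%:R * (eps ^+ 2 / (8 * Lg)).
  elim: t => [|t IH] tT; first by rewrite mul0r subr0.
  by have := step t tT; have := IH (ltnW tT); rewrite -natr1; lra.
(* The accumulated bound is an equality at 0, so strictness is taken from the last step, which
   exists because [0 < T]. *)
have := step T.-1; rewrite prednK// => /(_ (leqnn _)).
have := acc T.-1 (leq_pred _).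
have Dle := gap_D_ge l std Alb (th 0%N) (run_Th (leqnn T)).
have : gap_D Th Al h p q ahat l (th 0%N) <= T%:R * (eps ^+ 2 / (8 * Lg)).
  move: T_large; rewrite /N_T -/l -/Lg ler_pdivrMr ?exprn_gt0// mulrA ler_pdivlMr ?mulr_gt0//.
  by rewrite [_ * (8 * Lg)]mulrC.
rewrite -[in T%:R](prednK T0) -natr1; move: Dle; rewrite -/(G 0%N) -/(G T); lra.
Qed.

End convergence.

(** * Complexity *)

Section complexity.
Context {R : realType} {m n : nat}.
Variables (Th : set 'rV[R]_m) (Al : set 'rV[R]_n).
Variables (h : 'rV[R]_m -> 'rV[R]_n -> R) (p : 'rV[R]_n -> R) (q : 'rV[R]_m -> R).
Variables (rad L11 L22 L12 Lp : R) (ahat : 'rV[R]_n).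
Hypothesis std : standing Th Al h p q rad L11 L22 L12 Lp.
Hypothesis Alb : Al ahat.

Lemma lambda_inv_le : exists2 c, 0 < c & forall e, 0 < e -> e <= 1 ->
  (lambda L22 rad e)^-1 <= c / e.
Proof.
have L0 := L22_gt0 std; have r0 := rad_gt0 std.
have s0 : 0 < 2 * Num.sqrt 2 * rad by rewrite !mulr_gt0// sqrtr_gt0.
exists (L22^-1 + 2 * Num.sqrt 2 * rad) => [|e e0 e1]; first by rewrite addr_gt0// invr_gt0.
rewrite /lambda; have [_|_] := leP L22 (e / (2 * Num.sqrt 2 * rad)).
  rewrite ler_pdivlMr// (@le_trans _ _ L22^-1)//.
    by rewrite ler_piMr// invr_ge0 ltW.
  by rewrite lerDl ltW.
by rewrite invf_div ler_pM2r ?invr_gt0// lerDr invr_ge0 ltW.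
Qed.

Lemma L_g_le : exists2 c, 0 < c & forall e, 0 < e -> e <= 1 ->
  L_g L11 L12 (lambda L22 rad e) <= c / e.
Proof.
have [c c0 H] := lambda_inv_le; have k0 := L12_gt0 std; have L0 := L11_ge0 std.
exists (L11 + L12 ^+ 2 * c) => [|e e0 e1]; first by rewrite ltr_wpDl// mulr_gt0// exprn_gt0.
rewrite mulrDl lerD//; first by rewrite ler_pdivlMr// ler_piMr.
by rewrite -[leRHS]mulrA ler_pM2l ?exprn_gt0// H.
Qed.

(** The value of [g_reg] at [t0] is largest without regularization, and the minimum has a lower
    bound independent of the parameter. *)
Lemma gap_D_bounded t0 : Th t0 -> exists2 c, 0 < c & forall e, 0 < e ->
  0 <= gap_D Th Al h p q ahat (lambda L22 rad e) t0 <= c.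
Proof.
move=> T0; have [c H] := objective_lower_bound std Alb.
exists (`|g_reg Al h p ahat 0 t0 + q t0 - c| + 1) => [|e e0]; first by rewrite ltr_wpDl.
have l0 := lambda_gt0 (L22_gt0 std) (rad_gt0 std) e0.
apply/andP; split.
  by have := gap_D_ge (lambda L22 rad e) std Alb t0 T0; lra.
apply: (@le_trans _ _ (g_reg Al h p ahat 0 t0 + q t0 - c)); last first.
  by rewrite (le_trans (ler_norm _))// lerDl.
rewrite /gap_D lerB//.
  rewrite lerD2r; have [z az] := reg_argmax_exists (lambda L22 rad e) std Alb t0.
  rewrite (g_reg_argmax az); apply: le_trans (g_reg_ge 0 std Alb t0 az.1).
  by rewrite /h_reg mul0r mul0r subr0 lerD2r gerBl mulr_ge0 ?sqr_ge0// divr_ge0// ltW.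
by apply: minval_ge; [exists t0|move=> t; exact: H].
Qed.

Lemma N_T_bigO th0 : Th th0 ->
  (fun e : R => N_T Th Al h p q rad L11 L22 L12 ahat th0 e : R^o)
    =O_ (0^'+) (fun e : R => e ^- 3 : R^o).
Proof.
move=> T0; have [c c0 Hc] := L_g_le; have [d d0 Hd] := gap_D_bounded T0.
apply/eqO_exP; exists (8 * c * d); first by rewrite !mulr_gt0.
near=> e; have e0 : 0 < e by near: e; exact: nbhs_right_gt.
have e1 : e <= 1 by near: e; exact: nbhs_right_le.
have l0 := lambda_gt0 (L22_gt0 std) (rad_gt0 std) e0.
have Lg0 := L_g_gt0 std l0; have /andP[D0 D1] := Hd e e0.
rewrite /N_T ger0_norm; last by rewrite divr_ge0 ?sqr_ge0// !mulr_ge0// ltW.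
rewrite ger0_norm ?invr_ge0 ?exprn_ge0 ?(ltW e0)//.
rewrite [leRHS](_ : _ = (8 * (c / e) * d) / e ^+ 2); last by field; rewrite gt_eqF.
rewrite ler_pM2r ?invr_gt0 ?exprn_gt0// ler_pM//; first by rewrite mulr_ge0// ltW.
by rewrite ler_pM2l// Hc.
Unshelve. all: by end_near. Qed.

(** The constants [|ln a|] and [|ln b|] are absorbed because [ln e^-1] is at least 1; the lower
    bound [a] keeps the logarithm from being very negative. *)
Lemma ln_abs_le (a b x e : R) : 0 < a -> 0 < b -> 0 < e -> 1 <= ln e^-1 ->
  a <= x -> x <= b / e -> `|ln x| <= (`|ln a| + `|ln b| + 1) * ln e^-1.
Proof.
move=> a0 b0 e0 L1 ax xb; have x0 := lt_le_trans a0 ax.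
have H1 : ln a <= ln x by rewrite ler_ln.
have H2 : ln x <= ln b + ln e^-1.
  by rewrite -lnM ?posrE ?invr_gt0// ler_ln ?posrE// divr_gt0.
have := ler_norm (ln b); have := lerNnormlW (lexx `|ln a|).
have A0 := normr_ge0 (ln a); have B0 := normr_ge0 (ln b).
move: (`|ln a|) (`|ln b|) A0 B0 => A B A0 B0 H3 H4.
rewrite ler_norml; apply/andP; split; nra.
Qed.

(** The gradient is compared with its value at one fixed point through [lip12], [lip22] and the
    diameters, so the bound is uniform in [t] and [e]. *)
Lemma g_max_bounded : exists2 c, 0 < c & forall t e, Th t -> 0 < e ->
  0 <= g_max Al h rad (lambda L22 rad e) t <= c.
Proof.
have r0 := rad_gt0 std; have L0 := L22_gt0 std; have k0 := L12_gt0 std.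
have [Tn|T0] := pselect (exists t, Th t); last first.
  by exists 1 => // t e Tt; exfalso; apply: T0; exists t.
have [t0 Tt0] := Tn.
pose G := enorm (grad_al h t0 ahat).
exists (G + (L12 + L22) * (2 * rad) + L22 * rad) => [|t e Tt e0].
  by rewrite ltr_wpDl ?mulr_gt0// addr_ge0 ?enorm_ge0// ltW// !mulr_gt0// addr_gt0.
have l0 := lambda_gt0 L0 r0 e0.
rewrite addr_ge0 ?(maxval_grad_ge0 h Alb) ?mulr_ge0 ?(ltW l0) ?(ltW r0)//=.
rewrite lerD//; last by rewrite ler_pM2r// lambda_le.
apply: maxval_le; first by exists ahat.
move=> a Aa; have [c Bc] := ball_Th std; have [c' Bc'] := ball_Al std.
have H1 := le_trans (lip12 std Tt Tt0 Aa) (ler_wpM2l (ltW k0) (in_ball_diam Bc Tt Tt0)).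
have H2 := le_trans (lip22 std Tt0 Aa Alb) (ler_wpM2l (ltW L0) (in_ball_diam Bc' Aa Alb)).
have := enormB_ge (grad_al h t a) (grad_al h t0 a).
have := enormB_ge (grad_al h t0 a) (grad_al h t0 ahat); rewrite -/G.
move: (enorm _) (enorm _) (enorm _) (enorm _) G H1 H2.
by move=> {L0 k0 r0 l0} *; lra.
Qed.

Lemma sqrt_kappa_le : exists2 c, 0 < c & forall e, 0 < e -> e <= 1 ->
  Num.sqrt (8 * kappa L22 (lambda L22 rad e)) <= c * e `^ (- 2^-1).
Proof.
have [c c0 H] := lambda_inv_le; have L0 := L22_gt0 std.
exists (Num.sqrt (16 * L22 * c)) => [|e e0 e1]; first by rewrite sqrtr_gt0 !mulr_gt0.
have l0 := lambda_gt0 L0 (rad_gt0 std) e0.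
rewrite powRN powR12_sqrt ?(ltW e0)// -sqrtrV ?(ltW e0)//.
rewrite -sqrtrM; last by rewrite !mulr_ge0// ltW.
rewrite ler_wsqrtr// /kappa.
have H1 : (L22 + lambda L22 rad e) / lambda L22 rad e <= 2 * L22 * (c / e).
  rewrite ler_pM ?invr_ge0 ?addr_ge0 ?(ltW L0) ?(ltW l0) ?H//.
  by have := lambda_le L22 rad e; lra.
have -> : 16 * L22 * c * e^-1 = 8 * (2 * L22 * (c / e)) by ring.
by rewrite ler_pM2l.
Qed.

(** The iterate and the gap bound may vary with [e]; uniformity comes from [g_max_bounded] and from
    the constants [a] and [b]. *)
Lemma N_K_bigO (tht : R -> 'rV[R]_m) (Delta : R -> R) (a b : R) :
  (forall e, Th (tht e)) -> 0 < a -> (forall e, a <= Delta e <= b) ->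
  (fun e : R => N_K Al h rad L11 L22 L12 Lp (tht e) (Delta e) e : R^o)
    =O_ (0^'+) (fun e : R => e `^ (- 2^-1) * ln e^-1 : R^o).
Proof.
move=> Tt a0 Dab.
have r0 := rad_gt0 std; have L0 := L22_gt0 std; have k0 := L12_gt0 std.
have Lp0 := Lp_ge0 std.
have b0 : 0 < b by have /andP[] := Dab 1; lra.
have [c1 c10 H1] := lambda_inv_le; have [c2 c20 H2] := L_g_le.
have [c3 c30 H3] := g_max_bounded; have [c4 c40 H4] := sqrt_kappa_le.
pose B (u v : R) := `|ln u| + `|ln v| + 1.
have B0 u v : 0 < B u v by rewrite /B ltr_wpDl// addr_ge0.
(* [k] adds up the coefficients of [ln e^-1] in the bounds [S1] to [S5] below, the maximum in
   [C_const] being replaced by the sum of the absolute values of its entries. *)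
pose k := 2 * `|ln 2| + B (L12 ^+ 2 / L22 * L12 * rad) (c2 * L12 * rad)
  + (B L22 (2 * L22) + B rad (4 * L22 * rad + c3 + Lp + rad))
  + 2 * B 2 2 + 2^-1 * B (2 * a / L22) (2 * b * c1).
have kp : 0 < k.
  have := B0 (L12 ^+ 2 / L22 * L12 * rad) (c2 * L12 * rad).
  have := B0 L22 (2 * L22); have := B0 rad (4 * L22 * rad + c3 + Lp + rad).
  have := B0 2 2; have := B0 (2 * a / L22) (2 * b * c1).
  have := normr_ge0 (ln 2 : R); rewrite /k.
  by move: (B _ _) (B _ _) (B _ _) (B _ _) (B _ _) => *; lra.
apply/eqO_exP; exists (2 * c4 * k); first by rewrite !mulr_gt0.
near=> e; have e0 : 0 < e by near: e; exact: nbhs_right_gt.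
have e1 : e <= 1 by near: e; exact: nbhs_right_le.
have L1 : 1 <= ln e^-1.
  rewrite -[leLHS](@expRK R) ler_ln ?posrE ?invr_gt0 ?expR_gt0//.
  rewrite -[leLHS]invrK lef_pV2 ?posrE ?invr_gt0 ?expR_gt0//.
  by near: e; apply: nbhs_right_le; rewrite invr_gt0 expR_gt0.
have l0 := lambda_gt0 L0 r0 e0; have lL := lambda_le L22 rad e.
rewrite /N_K /C_const; set l := lambda L22 rad e in l0 lL *.
have Hl : l^-1 <= c1 / e := H1 e e0 e1.
have Lg0 := L_g_gt0 std l0; have HLg : L_g L11 L12 l <= c2 / e := H2 e e0 e1.
have /andP[g0 gc] := H3 _ e (Tt e) e0; rewrite -/l in g0 gc.
have /andP[Da Db] := Dab e.
have ie1 : 1 <= e^-1 by rewrite invf_ge1.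
have S1 : `|2 * ln 2 + ln (L_g L11 L12 l * L12 * rad)| <=
    (2 * `|ln 2| + B (L12 ^+ 2 / L22 * L12 * rad) (c2 * L12 * rad)) * ln e^-1.
  rewrite (le_trans (ler_normD _ _))// [leRHS]mulrDl; apply: lerD.
    by rewrite normrM ger0_norm// ler_peMr// mulr_ge0.
  apply: ln_abs_le; rewrite ?mulr_gt0 ?invr_gt0 ?exprn_gt0//.
    rewrite !ler_pM2r//; apply: (@le_trans _ _ (L12 ^+ 2 / l)).
      by rewrite ler_pM2l ?exprn_gt0// lef_pV2.
    by rewrite lerDr (L11_ge0 std).
  have -> : c2 * L12 * rad / e = c2 / e * L12 * rad by ring.
  by rewrite !ler_pM2r.
have S2 : `|ln (L22 + l)| <= B L22 (2 * L22) * ln e^-1.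
  apply: ln_abs_le; rewrite ?mulr_gt0//; first by rewrite lerDl ltW.
  by rewrite (@le_trans _ _ (2 * L22))//; [lra|rewrite ler_peMr// mulr_ge0// ltW].
have S3 : `|ln (2 * (L22 + l) * rad + g_max Al h rad l (tht e) + Lp + rad)| <=
    B rad (4 * L22 * rad + c3 + Lp + rad) * ln e^-1.
  have lr : l * rad <= L22 * rad by rewrite ler_pM2r.
  have lr0 : 0 < l * rad by rewrite mulr_gt0.
  have Lr0 : 0 < L22 * rad by rewrite mulr_gt0.
  have P0 : 0 < 4 * L22 * rad + c3 + Lp + rad by lra.
  apply: ln_abs_le => //; first by lra.
  rewrite (@le_trans _ _ (4 * L22 * rad + c3 + Lp + rad))//; first by lra.
  by rewrite ler_peMr// ltW.
have S4 : `|ln (2 / e)| <= B 2 2 * ln e^-1.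
  by apply: ln_abs_le => //; rewrite ler_peMr.
have S5 : `|ln (2 * Delta e / l)| <= B (2 * a / L22) (2 * b * c1) * ln e^-1.
  apply: ln_abs_le; rewrite ?mulr_gt0 ?invr_gt0//.
    by rewrite ler_pM ?invr_ge0 ?mulr_ge0 ?(ltW a0) ?(ltW L0) ?ler_pM2l ?lef_pV2.
  have -> : 2 * b * c1 / e = 2 * b * (c1 / e) by ring.
  have D0 : 0 <= Delta e by exact: le_trans (ltW a0) Da.
  by rewrite ler_pM ?invr_ge0 ?(ltW l0) ?mulr_ge0 ?ler_pM2l.
have Smax (u v : R) : `|Num.max u v| <= `|u| + `|v|.
  by have [_|_] := leP u v; rewrite ?lerDl ?lerDr.
have S6 := Smax (2 * ln 2 + ln (L_g L11 L12 l * L12 * rad))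
  (ln (L22 + l) + ln (2 * (L22 + l) * rad + g_max Al h rad l (tht e) + Lp + rad)).
have S7 := ler_normD (ln (L22 + l))
  (ln (2 * (L22 + l) * rad + g_max Al h rad l (tht e) + Lp + rad)).
rewrite !normrM [`|ln e^-1|]ger0_norm ?(le_trans ler01)//.
rewrite [`|2|]ger0_norm// [`|Num.sqrt _|]ger0_norm ?sqrtr_ge0//.
rewrite [`|_ `^ _|]ger0_norm ?powR_ge0//.
rewrite [leRHS](_ : _ = (2 * (c4 * e `^ (- 2^-1))) * (k * ln e^-1)); last by ring.
rewrite ler_pM ?mulr_ge0 ?sqrtr_ge0//; first by rewrite ler_pM2l// H4.
set C := Num.max _ _ in S6 *.
have := ler_normD (C + 2 * ln (2 / e)) (2^-1 * ln (2 * Delta e / l)).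
have := ler_normD C (2 * ln (2 / e)).
rewrite !normrM [`|2|]ger0_norm// [`|2^-1|]ger0_norm//.
rewrite /k; lra.
Unshelve. all: by end_near. Qed.

End complexity.

Theorem theorem3 (R : realType) (m n : nat)
    (Th : set 'rV[R]_m) (Al : set 'rV[R]_n)
    (h : 'rV[R]_m -> 'rV[R]_n -> R) (p : 'rV[R]_n -> R) (q : 'rV[R]_m -> R)
    (rad L11 L22 L12 Lp : R)
    (E : set 'rV[R]_n) (ahat : 'rV[R]_n) (th0 : 'rV[R]_m) :
  standing Th Al h p q rad L11 L22 L12 Lp ->
  concave_domain Th Al h L22 E ->
  Al ahat -> Th th0 ->
  [/\ (* L_g is a Lipschitz constant of the gradient of g_lambda *)
      forall eps : R, 0 < eps ->
        let l := lambda L22 rad eps in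
        let g := g_reg Al h p ahat l in
        (forall t, Th t -> differentiable (g : 'rV[R]_m -> R^o) t) /\
        (forall t1 t2, Th t1 -> Th t2 ->
          enorm (grad g t1 - grad g t2) <= L_g L11 L12 l * enorm (t1 - t2)),
      (* convergence to an eps-FNE of the original game *)
      forall (eps : R) (K T : nat) (Delta : nat -> R)
          (th : nat -> 'rV[R]_m) (al : nat -> 'rV[R]_n)
          (x y : nat -> nat -> nat -> 'rV[R]_n),
        let l := lambda L22 rad eps in
        let N := N_inner L22 l in
        0 < eps -> (0 < T)%N ->
        run Th Al (h_reg h ahat l) p q K T N (L22 + l)^-1 (L_g L11 L12 l)^-1
          th al x y ->
        th 0%N = th0 ->
        (forall t k j, (t < T)%N -> (k <= K %/ N)%N -> (1 <= j <= N)%N ->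
          E (y t k j)) ->
        (forall t, (t < T)%N ->
          g_reg Al h p ahat l (th t) - (h_reg h ahat l (th t) (al t) - p (al t))
            < Delta t) ->
        N_T Th Al h p q rad L11 L22 L12 ahat th0 eps <= T%:R ->
        (forall t, (t < T)%N ->
          N_K Al h rad L11 L22 L12 Lp (th t) (Delta t) eps <= K%:R) ->
        exists2 t, (t < T)%N
          & eps_FNE Th Al h p q L11 L22 eps (th t) (al t.+1),
      (* N_T = O(eps^-3) *)
      (fun e : R => N_T Th Al h p q rad L11 L22 L12 ahat th0 e : R^o)
        =O_ (0^'+) (fun e : R => e ^- 3 : R^o)
    & (* N_K = O(eps^(-1/2) log(1/eps)) *)
      forall (tht : R -> 'rV[R]_m) (Delta : R -> R) (a b : R),
        (forall e, Th (tht e)) ->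
        0 < a -> (forall e, a <= Delta e <= b) ->
        (fun e : R => N_K Al h rad L11 L22 L12 Lp (tht e) (Delta e) e : R^o)
          =O_ (0^'+) (fun e : R => e `^ (- 2^-1) * ln e^-1 : R^o)].
Proof.
move=> std cdom Aa T0; split.
- move=> eps e0 l g; have l0 := lambda_gt0 (L22_gt0 std) (rad_gt0 std) e0.
  split=> [t Tt|t1 t2]; last exact: (g_reg_grad_lip std cdom Aa l0).
  have [x ax] := reg_argmax_exists l std Aa t.
  exact: (g_reg_diff std cdom Aa l0 Tt ax).1.
- move=> eps K T Delta th al x y l N e0 Tpos runs th0E y_in gap.
  rewrite -th0E => T_large K_large.
  exact: (convergence std cdom Aa e0 runs y_in gap K_large Tpos T_large).
- exact: (N_T_bigO std Aa T0).
- exact: (N_K_bigO std Aa).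
Qed.
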